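(* For a positive integer $n$, the Diophantine equation $$\frac{x(x-1)}2+\frac{y(y-1)}2+6\,\frac{z(z-1)}2=n$$ has an integer solution $(x,y,z)\in\mathbb Z^3$ if and only if $n\not\equiv 2\cdot 3^{2r-1}-1\pmod{3^{2r}}$ for every positive integer $r$. *)

(* Defs.v *)
From mathcomp Require Import all_boot all_order all_algebra.
Set Implicit Arguments.
Unset Strict Implicit.
Unset Printing Implicit Defensive.

Import Order.TTheory GRing.Theory Num.Theory.
Local Open Scope ring_scope.

(* The Euclidean quotient is the exact one here: x * (x - 1) is even for every
   integer x, including negative ones. *)
Definition triangular (x : int) : int := (x * (x - 1) %/ 2)%Z.

(* Main.v *)
Require Import Defs.
From mathcomp Require Import all_boot all_order all_algebra.
From mathcomp Require Import fingroup cyclic finfield.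
From mathcomp Require Import reals exp Rstruct.
From mathcomp Require Import zify lra ring.
Set Implicit Arguments.
Unset Strict Implicit.
Unset Printing Implicit Defensive.

Import Order.TTheory GRing.Theory Num.Theory.
Local Open Scope ring_scope.

(** With N = n + 1, completing squares turns the equation into
    8N = X^2 + Y^2 + 6Z^2 with X, Y, Z odd, that is, into
    4N = a^2 + b^2 + 3c^2 with c odd. A descent modulo 3 shows that this forces
    N <> 3^(2j+1) (3m+2).

    Conversely, assume N is not of this form. After removing square factors one chooses,
    according to whether 3 divides N, a prime q that is a norm from Q(sqrt -3) and
    such that x^2 + q w^2 = N t^2 is solvable by Legendre's theorem; hence N is
    represented by x^2 + y^2 + 3z^2 over Q. Since this form is rationally equivalent to
    x^2 + y^2 + yz + z^2, whose covering radius is less than 1, the Davenport-Cassels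
    descent gives an integral representation of N by the latter, and a parity argument
    produces c odd.

    The conditions on q only prescribe finitely many quadratic symbols, so instead
    of Dirichlet's full theorem it is enough to run Mertens' argument for real
    characters, with Monsky's proof that L(1, chi) <> 0. *)

(** * Sums over divisors *)

(** The symbols imposed on q are dictated by reciprocity. If 3 does not divide the squarefree N,
    solving x^2 + q w^2 = N t^2 needs (-q/p) = 1 for the odd p | N and (N/q) = 1. Taking q = 7 mod 8
    and (q/p) = (-1/p) gives the first condition and makes every (p/q) equal to 1, including (2/q).

    If N = 3N', the equation actually solved is 3x^2 + q w^2 = N' t^2, which needs (-3q/p) = 1 and
    (3N'/q) = 1. With q = 5 mod 8, q = 1 mod 3 and (q/p) = (p/3), the first condition holds, (3/q) =
    1, and (p/q) = (p/3) for every p | N', including 2. Hence (N'/q) = (N'/3): this is the only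
    place where N' = 1 mod 3, that is, the exclusion, is used. *)

Lemma sum_multiples (V : nmodType) (d x : nat) (F : nat -> V) : (0 < d)%N ->
  \sum_(1 <= n < x.+1 | (d %| n)%N) F (n %/ d)%N
    = \sum_(1 <= e < (x %/ d).+1) F e.
Proof.
move=> d0; elim: x => [|x IH]; first by rewrite div0n !big_geq.
rewrite big_mkcond big_nat_recr //= -big_mkcond /= IH divnS //.
case: ifP => [dx|_]; last by rewrite addr0 add0n.
rewrite add1n [RHS]big_nat_recr //=; congr (_ + F _).
  by rewrite dx add1n.
Qed.

Lemma sum_divisors_widen (V : nmodType) (n x : nat) (F : nat -> V) :
  (0 < n <= x)%N ->
  \sum_(1 <= d < n.+1 | (d %| n)%N) F d = \sum_(1 <= d < x.+1 | (d %| n)%N) F d.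
Proof.
case/andP=> n0 nx; rewrite (@big_cat_nat _ _ _ n.+1 1 x.+1) //=.
rewrite [X in _ + X]big_nat_cond [X in _ + X]big1 ?addr0 // => d.
by case/andP=> /andP[nd _] /(dvdn_leq n0); lia.
Qed.

(** Pairs d | n with n <= x correspond to pairs (d, e) with d e <= x. The Lambert expansion and the
    Mertens sums below all go through this exchange. *)
Lemma sum_divisors_swap (V : nmodType) (x : nat) (F : nat -> nat -> V) :
  \sum_(1 <= n < x.+1) \sum_(1 <= d < n.+1 | (d %| n)%N) F d (n %/ d)%N
    = \sum_(1 <= d < x.+1) \sum_(1 <= e < (x %/ d).+1) F d e.
Proof.
under eq_big_nat => n nx do
  rewrite (@sum_divisors_widen V n x (fun d => F d (n %/ d)%N)) // big_mkcond.
rewrite exchange_big /=; apply: eq_big_nat => d dx.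
by rewrite -big_mkcond sum_multiples //; case/andP: dx.
Qed.

Section Character.
Variables (R : realFieldType) (chi : nat -> R).
Hypothesis chiM : forall m n, chi (m * n)%N = chi m * chi n.
Hypothesis chi1 : chi 1 = 1.
Hypothesis chi_val : forall n, [|| chi n == 0, chi n == 1 | chi n == -1].

Lemma chi_le1 n : `|chi n| <= 1.
Proof. by case/or3P: (chi_val n) => /eqP->; rewrite ?normr0 ?normrN ?normr1. Qed.

(** The m-th coefficient of the Dirichlet series zeta(s) L(s, chi). *)
Definition divisor_sum m : R := \sum_(1 <= d < m.+1 | (d %| m)%N) chi d.

(* A divisor of p m is either prime to p, hence divides m', or p times a divisor of m. *)
Lemma divisor_sumMp p e m' : prime p -> ~~ (p %| m')%N -> (0 < m')%N ->
  divisor_sum (p * (p ^ e * m'))%N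
    = divisor_sum m' + chi p * divisor_sum (p ^ e * m')%N.
Proof.
move=> pp pm' m0; have p0 := prime_gt0 pp.
have pe0 : (0 < p ^ e)%N by rewrite expn_gt0 p0.
set m := (p ^ e * m')%N; have m_gt0 : (0 < m)%N by rewrite muln_gt0 pe0.
rewrite {1}/divisor_sum (bigID (fun d => p %| d)%N) /= addrC; congr (_ + _).
  rewrite [RHS](@sum_divisors_widen _ m' (p * m)); last first.
    by rewrite m0 /= /m mulnA leq_pmull // muln_gt0 p0.
  apply: eq_bigl => d; case: (boolP (p %| d)%N) => pd /=.
    by rewrite andbF; apply/esym/negbTE; apply: contra pm' => /(dvdn_trans pd).
  rewrite andbT /m mulnA -expnS Gauss_dvdr //.
  by rewrite coprimeXr // coprime_sym prime_coprime.
rewrite /divisor_sum mulr_sumr.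
have -> : \sum_(1 <= d < m.+1 | (d %| m)%N) chi p * chi d =
  \sum_(1 <= d < (p * m %/ p).+1) if (d %| m)%N then chi p * chi d else 0.
  by rewrite mulKn // -big_mkcond.
rewrite -sum_multiples // big_mkcond [RHS]big_mkcond; apply: eq_bigr => d _.
case: (boolP (p %| d)%N) => [/dvdnP[c ->]|_]; last by rewrite andbF.
by rewrite andbT mulnK // [(p * m)%N]mulnC dvdn_pmul2r // mulnC chiM.
Qed.

Lemma divisor_sum1 : divisor_sum 1 = 1.
Proof. by rewrite /divisor_sum big_mkcond big_nat1 dvd1n. Qed.

Lemma divisor_sum_pfactor p e m' : prime p -> ~~ (p %| m')%N -> (0 < m')%N ->
  divisor_sum (p ^ e * m')%N = divisor_sum m' * \sum_(i < e.+1) chi p ^+ i.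
Proof.
move=> pp pm' m0; elim: e => [|e IH].
  by rewrite expn0 mul1n big_ord1 expr0 mulr1.
rewrite expnS -mulnA divisor_sumMp // IH [in RHS]big_ord_recl expr0 mulrDr mulr1.
congr (_ + _); rewrite mulrCA mulr_sumr; congr (_ * _).
by apply: eq_bigr => i _; rewrite exprS.
Qed.

(** For chi p = -1 the partial sums alternate between 1 and 0, hence the induction in steps of
    two. *)
Lemma geom_chi_ge0 p e : 0 <= \sum_(i < e.+1) chi p ^+ i.
Proof.
case/or3P: (chi_val p) => /eqP->.
- by apply: sumr_ge0 => i _; rewrite exprn_ge0.
- by apply: sumr_ge0 => i _; rewrite exprn_ge0.
- elim: e {-2}e (leqnn e) => [|n IH] [|[|e]] // le_en.
  + by rewrite big_ord1.
  + by rewrite big_ord1.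
  + by rewrite !big_ord_recl big_ord0; lra.
  rewrite 2!big_ord_recr /=; have := IH e.
  rewrite !exprS; have -> : (e <= n)%N by lia.
  by move=> /(_ isT); lra.
Qed.

Lemma geom_chi_ge1 p e : ~~ odd e -> 1 <= \sum_(i < e.+1) chi p ^+ i.
Proof.
case/or3P: (chi_val p) => /eqP-> ev.
- by rewrite big_ord_recl expr0 lerDl sumr_ge0 // => i _; rewrite exprn_ge0.
- by rewrite big_ord_recl expr0 lerDl sumr_ge0 // => i _; rewrite exprn_ge0.
- have -> : e = (e./2).*2 by lia.
  elim: (e./2) => [|n IH]; first by rewrite big_ord1 expr0.
  by rewrite doubleS 2!big_ord_recr /= !exprS; lra.
Qed.

(** Split off the full power of the smallest prime factor. Each local factor is nonnegative; in a
    square every exponent is even, and then the local factor is at least 1. *)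
Lemma divisor_sum_bounds m : (0 < m)%N ->
  0 <= divisor_sum m /\ ((exists j, m = (j ^ 2)%N) -> 1 <= divisor_sum m).
Proof.
elim/ltn_ind: m => m IH m0.
have [->|m1] : m = 1%N \/ (1 < m)%N by lia.
  by rewrite divisor_sum1.
have pp := pdiv_prime m1; set p := pdiv m in pp.
have [m' pm' mE] := pfactor_coprime pp m0; set e := logn p m in mE.
have p1 := prime_gt1 pp.
have e0 : (0 < e)%N by rewrite logn_gt0 mem_primes pp m0 pdiv_dvd.
rewrite prime_coprime // in pm'.
have m'0 : (0 < m')%N by move: m0; rewrite mE muln_gt0; case/andP.
have m'm : (m' < m)%N 
  by rewrite mE ltn_Pmulr // (leq_trans p1) // (leq_pexp2l (ltnW p1) e0).
have [r0 r1] := IH _ m'm m'0.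
rewrite mE mulnC divisor_sum_pfactor //; split.
  by rewrite mulr_ge0 // geom_chi_ge0.
move=> [j jE].
have j0 : (0 < j)%N by move: m0; rewrite mE mulnC jE sqrn_gt0.
have [j' pj' j'E] := pfactor_coprime pp j0; set f := logn p j in j'E.
rewrite prime_coprime // in pj'.
have eE : e = (f * 2)%N.
  by rewrite mulnC -lognX -jE mulnC -mE.
rewrite -[X in X <= _]mul1r ler_pM ?ler01 //; last first.
  by apply: geom_chi_ge1; rewrite eE; lia.
apply: r1; exists j'.
apply/eqP; rewrite -(eqn_pmul2r (_ : 0 < p ^ e)%N) ?expn_gt0 ?(ltnW p1) //.
by rewrite {2}eE expnM -expnMn -j'E -jE mulnC.
Qed.

End Character.

(** * Sums of periodic functions *)

Section Periodic.
Variables (R : realFieldType) (chi : nat -> R) (k : nat).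
Hypothesis k_gt0 : (0 < k)%N.
Hypothesis chi_le1 : forall n, `|chi n| <= 1.
Hypothesis chi_per : forall n, chi (n + k)%N = chi n.
Hypothesis chi_sum0 : \sum_(0 <= n < k) chi n = 0.

Let P x := \sum_(0 <= n < x) chi n.

Lemma periodic_sum_bound x : `|\sum_(0 <= n < x) chi n| <= k%:R.
Proof.
have PD y : P (y + k) = P y.
  rewrite /P; elim: y => [|y IH]; first by rewrite add0n chi_sum0 big_geq.
  by rewrite addSn !big_nat_recr //= IH chi_per.
rewrite -/(P x); have -> : P x = P (x %% k)%N.
  rewrite {1}(divn_eq x k) addnC; elim: (x %/ k)%N => [|m IH].
    by rewrite mul0n addn0.
  by rewrite mulSn addnCA addnC PD.
apply: (le_trans (ler_norm_sum _ _ _)).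
apply: (@le_trans _ _ (\sum_(0 <= n < (x %% k)%N) 1)); first exact: ler_sum.
rewrite sumr_const_nat subn0 ler_nat.
exact: ltnW (ltn_pmod _ _).
Qed.

(** Summation by parts. A sum of chi over an interval is a difference of two prefix sums, each at
    most k in absolute value, whence the factor 2k. *)
Lemma abel_bound (b : nat -> R) (a x : nat) :
  (a <= x)%N -> (forall n, (a <= n)%N -> 0 <= b n) ->
  (forall n, (a <= n)%N -> b n.+1 <= b n) ->
  `|\sum_(a <= n < x) chi n * b n| <= 2 * k%:R * b a.
Proof.
move=> ax b0 bdec.
pose Q y := P y - P a.
have Qb y : `|Q y| <= 2 * k%:R.
  apply: (le_trans (ler_normB _ _)); rewrite mulr_natl mulr2n.
  by rewrite lerD // periodic_sum_bound.
(* Keeping the boundary term on the left makes the right side telescope, so that the induction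
   closes. *)
have key : `|\sum_(a <= n < x) chi n * b n - Q x * b x|
             <= 2 * k%:R * (b a - b x).
  rewrite -(subnKC ax); elim: (x - a)%N => [|m IH].
    by rewrite addn0 big_geq // /Q !subrr mul0r subrr normr0 mulr0.
  have am : (a <= a + m)%N by rewrite leq_addr.
  rewrite addnS big_nat_recr //=.
  have QS : Q (a + m).+1 = Q (a + m)%N + chi (a + m)%N.
    by rewrite /Q /P big_nat_recr //=; ring.
  have -> : \sum_(a <= i < a + m) chi i * b i + chi (a + m)%N * b (a + m)%N
      - Q (a + m).+1 * b (a + m).+1
    = (\sum_(a <= i < a + m) chi i * b i - Q (a + m)%N * b (a + m)%N)
      + Q (a + m).+1 * (b (a + m)%N - b (a + m).+1).
    by rewrite QS; ring.
  apply: (le_trans (ler_normD _ _)).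
  have bm := bdec _ am.
  have := ler_wpM2r (_ : 0 <= b (a + m)%N - b (a + m).+1) (Qb (a + m).+1).
  rewrite normrM subr_ge0 => /(_ bm).
  have -> : `|b (a + m)%N - b (a + m).+1| = b (a + m)%N - b (a + m).+1.
    by rewrite ger0_norm // subr_ge0.
  by move: IH; lra.
have := ler_wpM2r (b0 _ ax) (Qb x).
rewrite -{1}(ger0_norm (b0 _ ax)) -normrM.
have := ler_normD (\sum_(a <= n < x) chi n * b n - Q x * b x) (Q x * b x).
rewrite subrK; move: key; lra.
Qed.

(** The partial sum up to x of the series for L(1, chi). *)
Definition harmonic x : R := \sum_(1 <= n < x.+1) chi n / n%:R.

Lemma harmonic_tail y x : (y <= x)%N ->
  `|harmonic x - harmonic y| <= 2 * k%:R / y.+1%:R.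
Proof.
move=> yx; rewrite /harmonic (@big_cat_nat _ _ _ y.+1 1 x.+1) //= addrAC subrr add0r.
apply: (@abel_bound (fun n => n%:R^-1)) => // n yn.
- by rewrite invr_ge0.
- by rewrite lef_pV2 ?posrE ?ltr0n ?ler_nat //; lia.
Qed.

End Periodic.

(** * Monotonicity of the Lambert kernel *)

Section Lambert.
Variable (R : realFieldType).

Lemma geomS_sum (t : R) n : (1 - t) * \sum_(i < n) t ^+ i = 1 - t ^+ n.
Proof. by rewrite -opprB -[RHS]opprB subrX1 mulNr. Qed.

(** AM-GM: the first and last terms add up to at least 2 s^(n-1), and the terms in between are s^2
    times the same sum with n - 2 terms. *)
Lemma geom_sum_ge (s : R) n : 0 <= s -> n%:R * s ^+ n.-1 <= \sum_(i < n) (s ^+ 2) ^+ i.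
Proof.
move=> s0; elim: n {-2}n (leqnn n) => [|m IH] [|[|n]] // le_nm.
- by rewrite big_ord0 mul0r.
- by rewrite big_ord0 mul0r.
- by rewrite big_ord1 !expr0 mulr1.
rewrite big_ord_recl big_ord_recr /=.
have -> : \sum_(i < n) (s ^+ 2) ^+ bump 0 i = s ^+ 2 * \sum_(i < n) (s ^+ 2) ^+ i.
  by rewrite mulr_sumr; apply: eq_bigr => i _; rewrite -exprS.
have := IH n (_ : n <= m)%N; rewrite (_ : (n <= m)%N); last by lia.
move=> /(_ isT) IHn.
have h : n%:R * s ^+ n.+1 <= s ^+ 2 * \sum_(i < n) (s ^+ 2) ^+ i.
  apply: le_trans (ler_wpM2l (exprn_ge0 2 s0) IHn).
  case: (n) => [|j]; first by rewrite !mul0r mulr0.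
  by rewrite /= !exprS; apply/eqP/eqP; nra || lra.
rewrite /bump /= add1n -exprM mulnC exprM expr0 -[n.+2]addn2 natrD mulrDl.
have : 0 <= (1 - s ^+ n.+1) ^+ 2 by rewrite sqr_ge0.
by move: h; rewrite -exprM mulnC exprM; lra.
Qed.

(** As t tends to 1, t^m/(1 - t^m) is close to 1/(m(1 - t)), so this difference compares the Lambert
    series with [harmonic]/(1 - t). It equals 1 at m = 1. *)
Definition lambert_gap (t : R) (m : nat) :=
  (m%:R * (1 - t))^-1 - t ^+ m / (1 - t ^+ m).

(* This reduces to the AM-GM bound [n (n + 1) t^n <= S_n S_(n+1)] for the
   geometric sums [S_n]; taking [t] a square keeps the exponents integral. *)
Lemma lambert_gap_decr (s : R) n : 0 < s -> s < 1 -> (0 < n)%N ->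
  lambert_gap (s ^+ 2) n.+1 <= lambert_gap (s ^+ 2) n.
Proof.
move=> s0 s1 n0; rewrite /lambert_gap; set t := s ^+ 2.
have t0 : 0 < t by rewrite exprn_gt0.
have t1 : t < 1 by rewrite expr_lt1 // ltW.
have u0 : 0 < 1 - t by lra.
rewrite -(geomS_sum t n) -(geomS_sum t n.+1).
have g1 := @geom_sum_ge s n (ltW s0); have g2 := @geom_sum_ge s n.+1 (ltW s0).
rewrite -/t /= in g1 g2.
set S := \sum_(i < n) t ^+ i in g1 *; set S' := \sum_(i < n.+1) t ^+ i in g2 *.
have S'E : S' = S + t ^+ n by rewrite /S' big_ord_recr.
have nr : 0 < n%:R :> R by rewrite ltr0n.
have Sp : 0 < S.
  by apply: lt_le_trans g1; rewrite mulr_gt0 // exprn_gt0.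
have Sp' : 0 < S' by rewrite S'E addr_gt0 // exprn_gt0.
have tn : t ^+ n = 1 - (1 - t) * S by rewrite geomS_sum; ring.
have tn' : t ^+ n.+1 = 1 - (1 - t) * S' by rewrite geomS_sum; ring.
have key : n%:R * n.+1%:R * t ^+ n <= S * S'.
  apply: (@le_trans _ _ ((n%:R * s ^+ n.-1) * (n.+1%:R * s ^+ n))).
    rewrite mulrACA ler_wpM2l ?mulr_ge0 ?ler0n //.
    rewrite -exprD /t -exprM ler_wiXn2l ?ltW //; lia.
  by rewrite ler_pM // ?mulr_ge0 ?exprn_ge0 ?ler0n ?(ltW s0).
rewrite tn tn' -subr_ge0.
have -> : (n%:R * (1 - t))^-1 - (1 - (1 - t) * S) / ((1 - t) * S) -
  ((n.+1%:R * (1 - t))^-1 - (1 - (1 - t) * S') / ((1 - t) * S'))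
  = (S * S' - n%:R * n.+1%:R * (S' - S)) / ((1 - t) * n%:R * n.+1%:R * S * S').
  rewrite -natr1; field.
  by rewrite !lt0r_neq0 // natr1.
rewrite divr_ge0 //; last by rewrite !mulr_ge0 // ltW.
by rewrite subr_ge0 S'E addrC addKr -S'E.
Qed.

End Lambert.

(** * Nonvanishing of L(1, chi) *)

Section Estimates.
Variable R : archiRealFieldType.

Lemma bernoulli_sub (u : R) n : 0 <= u <= 1 -> 1 - n%:R * u <= (1 - u) ^+ n.
Proof.
move=> /andP[u0 u1]; elim: n => [|n IH]; first by rewrite mul0r subr0.
have n0 : 0 <= n%:R :> R by [].
have : 0 <= 1 - u by lra.
move=> /(ler_wpM2l)/(_ _ _ IH); rewrite exprS -natr1.
by move: n0; move: (_ ^+ n) (n%:R) => a b b0; nra.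
Qed.

Lemma exp_mul_le1 (u : R) n : 0 <= u <= 1 -> (1 - u) ^+ n * (1 + n%:R * u) <= 1.
Proof.
move=> /andP[u0 u1]; elim: n => [|n IH]; first by rewrite mul0r addr0 mulr1.
have n0 : 0 <= n%:R :> R by [].
have a0 : 0 <= (1 - u) ^+ n by rewrite exprn_ge0 // subr_ge0.
rewrite exprS -natr1; move: IH n0 a0; move: (_ ^+ n) (n%:R) => a b h b0 a0.
apply: le_trans h; rewrite mulrC mulrA mulrC ler_wpM2l //.
have : 0 <= b * u * u by rewrite !mulr_ge0.
have : 0 <= u * u by rewrite mulr_ge0.
lra.
Qed.

(** With u = (1 - t)/2 one has t <= (1 - u)^2. A single factor (1 - u)^X <= 1/(Xu) would only
    compensate X; the square leaves X t^X <= 1/(X u^2). *)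
Lemma mul_exp_small (t e : R) : 0 < t < 1 -> 0 < e ->
  exists X0, forall X, (X0 <= X)%N -> X%:R * t ^+ X <= e.
Proof.
move=> /andP[t0 t1] e0; pose u : R := (1 - t) / 2.
have u0 : 0 < u by rewrite /u; lra.
have u1 : u <= 1 by rewrite /u; lra.
have tu : t <= (1 - u) ^+ 2.
  have -> : (1 - u) ^+ 2 = t + ((1 - t) / 2) ^+ 2 by rewrite /u; field.
  by rewrite lerDl sqr_ge0.
exists (Num.bound (u ^- 2 / e)).+1 => X X0.
have X1 : 0 < X%:R :> R by rewrite ltr0n; lia.
have hX : u ^- 2 / e <= X%:R.
  apply: le_trans (ltW (archi_boundP _)) _; last by rewrite ler_nat; lia.
  by rewrite divr_ge0 ?invr_ge0 ?exprn_ge0 // ltW.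
have u01 : 0 <= u <= 1 by rewrite ltW.
have hb := exp_mul_le1 X u01.
have tX : t ^+ X <= ((1 - u) ^+ X) ^+ 2.
  rewrite -exprM mulnC exprM; apply: lerXn2r => //; rewrite nnegrE ?ltW //.
  exact: lt_le_trans t0 tu.
have a0 : 0 <= (1 - u) ^+ X by rewrite exprn_ge0 // subr_ge0.
have hb2 : (1 - u) ^+ X * (X%:R * u) <= 1.
  by apply: le_trans hb; rewrite ler_wpM2l // lerDr.
have hb3 : ((1 - u) ^+ X) ^+ 2 * (X%:R * u) ^+ 2 <= 1.
  rewrite -exprMn; apply: exprn_ile1 => //.
  by rewrite mulr_ge0 // mulr_ge0 // ltW.
have e1 : 1 <= X%:R * u ^+ 2 * e.
  move: hX; rewrite ler_pdivrMr // -[u ^- 2]mul1r ler_pdivrMr ?exprn_gt0 //.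
  by rewrite mulrAC.
apply: le_trans (ler_wpM2l (ltW X1) tX) _.
have Xu : 0 < X%:R * u ^+ 2 by rewrite mulr_gt0 // exprn_gt0.
rewrite -(ler_pM2r Xu).
have -> : X%:R * (1 - u) ^+ X ^+ 2 * (X%:R * u ^+ 2)
  = (1 - u) ^+ X ^+ 2 * (X%:R * u) ^+ 2 by ring.
by apply: le_trans hb3 _; rewrite mulrC.
Qed.

Variables (chi : nat -> R) (k : nat).
Hypothesis chiM : forall m n, chi (m * n)%N = chi m * chi n.
Hypothesis chi1 : chi 1 = 1.
Hypothesis chi_val : forall n, [|| chi n == 0, chi n == 1 | chi n == -1].
Hypothesis k_gt0 : (0 < k)%N.
Hypothesis chi_per : forall n, chi (n + k)%N = chi n.
Hypothesis chi_sum0 : \sum_(0 <= n < k) chi n = 0.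

Let chi_le1 := chi_le1 chi_val.

Lemma divisor_sum_term_ge0 (t : R) m : 0 < t -> (0 < m)%N ->
  0 <= divisor_sum chi m * t ^+ m.
Proof.
move=> t0 m0; rewrite mulr_ge0 //; last by rewrite exprn_ge0 // ltW.
by case: (divisor_sum_bounds chiM chi1 chi_val m0).
Qed.

(** Only the squares i^2 <= j^2 are kept; each contributes at least t^(i^2) >= t^(J^2). Separating j
    from J lets the induction run with a fixed power of t. *)
Lemma divisor_sum_squares (t : R) J j : 0 < t < 1 -> (j <= J)%N ->
  j%:R * t ^+ (J ^ 2) <=
  \sum_(1 <= m < (j ^ 2).+1) divisor_sum chi m * t ^+ m.
Proof.
move=> /andP[t0 t1]; elim: j => [|j IH] jJ.
  by rewrite mul0r big_geq.
have lej : (j ^ 2 < j.+1 ^ 2)%N by rewrite ltn_exp2r.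
rewrite (@big_cat_nat _ _ _ (j ^ 2).+1) //=; last by lia.
rewrite -natr1 mulrDl mul1r lerD ?IH 1?ltnW //.
rewrite big_nat_recr //= -[leLHS]add0r lerD //.
  rewrite big_nat_cond sumr_ge0 // => m /andP[/andP[jm _] _].
  by apply: divisor_sum_term_ge0 => //; exact: leq_ltn_trans (leq0n _) jm.
have [|_ /(_ (ex_intro _ _ erefl)) h] :=
  @divisor_sum_bounds _ _ chiM chi1 chi_val (j.+1 ^ 2); first by rewrite expn_gt0.
apply: (@le_trans _ _ (t ^+ (j.+1 ^ 2))).
  by rewrite ler_wiXn2l ?ltW // leq_exp2r.
by rewrite ler_peMl // exprn_ge0 // ltW.
Qed.

(** Expand each t^n/(1 - t^n) as a geometric series. Cutting it at n e <= X leaves a tail of at most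
    t^X/(1 - t), and there are X values of n. *)
Lemma lambert_truncate (t : R) X : 0 < t < 1 ->
  \sum_(1 <= m < X.+1) divisor_sum chi m * t ^+ m - X%:R * t ^+ X / (1 - t)
  <= \sum_(1 <= n < X.+1) chi n * (t ^+ n / (1 - t ^+ n)).
Proof.
move=> /andP[t0 t1].
have -> : \sum_(1 <= m < X.+1) divisor_sum chi m * t ^+ m =
  \sum_(1 <= n < X.+1) \sum_(1 <= e < (X %/ n).+1) chi n * t ^+ (n * e).
  rewrite -(sum_divisors_swap X (fun d e => chi d * t ^+ (d * e))).
  apply: eq_bigr => m _; rewrite /divisor_sum mulr_suml.
  by apply: eq_bigr => d dm; rewrite [(d * _)%N]mulnC divnK.
have -> : X%:R * t ^+ X / (1 - t) = \sum_(1 <= n < X.+1) t ^+ X / (1 - t).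
  by rewrite sumr_const_nat subSS subn0 -mulrA mulr_natl.
rewrite -sumrB ler_sum_nat // => n /andP[n0 nX].
set E := (X %/ n)%N.
have tn1 : t ^+ n <= t by rewrite -[leRHS]expr1 ler_wiXn2l ?ltW.
have d0 : 0 < 1 - t ^+ n by lra.
have geo : t ^+ n / (1 - t ^+ n)
  = \sum_(1 <= e < E.+1) t ^+ (n * e) + t ^+ (n * E.+1) / (1 - t ^+ n).
  elim: E => [|E IH]; first by rewrite big_geq // muln1 add0r.
  rewrite IH [in RHS]big_nat_recr //= -addrA; congr (_ + _).
  rewrite [(n * E.+2)%N]mulnS exprD; field; exact: lt0r_neq0.
rewrite geo mulrDr mulr_sumr lerD2l.
have [b0 b1] : 0 <= t ^+ (n * E.+1) / (1 - t ^+ n) /\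
   t ^+ (n * E.+1) / (1 - t ^+ n) <= t ^+ X / (1 - t).
  split; first by rewrite divr_ge0 ?exprn_ge0 // ltW.
  rewrite ler_pM ?exprn_ge0 ?invr_ge0 ?(ltW t0) ?(ltW d0) //.
    rewrite ler_wiXn2l ?ltW // mulnC ltnW //.
    exact: ltn_ceil.
  by rewrite lef_pV2 ?posrE //; lra.
by case/or3P: (chi_val n) => /eqP->; lra.
Qed.

(* Monsky's argument: the Lambert series [\sum_n r(n) t^n], with
   [r = divisor_sum chi], would stay bounded as [t -> 1] if [L(1, chi) = 0],
   whereas [r] is nonnegative and at least 1 on squares. A single [t] and
   truncated sums suffice. *)
Lemma harmonic_lower_bound :
  exists c X0, 0 < c /\ forall X, (X0 <= X)%N -> c <= harmonic chi X.
Proof.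
(* The goal is J t^(J^2) >= 2k + 2: the 2k pays for the Abel bound and the 2 for the truncation
   error and the final gain. The factor 2 in [hJ] is the cost of t^(J^2) >= 1/2. *)
have [J Jpos hJ] : exists2 J, (0 < J)%N & ((2 * k + 2) * 2 <= J)%N.
  by exists (4 * k + 4)%N; lia.
have J4 : (1 < 4 * J ^ 2)%N.
  by rewrite (leq_trans (_ : 1 < 4)%N) // leq_pmulr // expn_gt0 Jpos.
(* With this v, Bernoulli's bound for (1 - v)^(2 J^2) is exactly 1/2. *)
pose v : R := (4 * J ^ 2)%:R^-1.
have J0 : 0 < (4 * J ^ 2)%:R :> R by rewrite ltr0n ltnW.
have v0 : 0 < v by rewrite invr_gt0.
have v1 : v < 1.
  by rewrite invf_lt1 // ltr1n.
pose s := 1 - v; pose t := s ^+ 2.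
have s0 : 0 < s by rewrite /s; lra.
have s1 : s < 1 by rewrite /s; lra.
have t0 : 0 < t by rewrite exprn_gt0.
have t1 : t < 1 by rewrite expr_lt1 // ltW.
have t01 : 0 < t < 1 by rewrite t0.
have u0 : 0 < 1 - t by lra.
have tJ : 2^-1 <= t ^+ (J ^ 2).
  rewrite /t -exprM; have v01 : 0 <= v <= 1 by rewrite !ltW.
  apply: le_trans (bernoulli_sub (2 * J ^ 2) v01).
  have : (4 * J ^ 2)%:R * v = 1 by rewrite mulfV // lt0r_neq0.
  by rewrite !natrM; lra.
(* From here on t is fixed; X is taken so large that the truncation error X t^X/(1 - t) is at most
   1, which leaves [harmonic]/(1 - t) >= 1. *)
have [X1 hX1] := @mul_exp_small t (1 - t) t01 u0.
exists (1 - t), (maxn X1 (J ^ 2)); split=> // X; rewrite geq_max => /andP[hX JX].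
have small := hX1 _ hX.
have gap0 n : (1 <= n)%N -> 0 <= lambert_gap t n.
  move=> n0; have n0' : 0 < n%:R :> R by rewrite ltr0n.
  have tn : t ^+ n < 1 by rewrite exprn_ilt1 ?(ltW t0) // -lt0n.
  rewrite /lambert_gap subr_ge0 -[leRHS]mul1r ler_pdivrMr ?subr_gt0 //.
  rewrite mulrAC ler_pdivlMr ?mulr_gt0 // mul1r -geomS_sum mulrCA mulrC.
  rewrite -mulrA mulrCA ler_wpM2l ?(ltW u0) // mulr_natr.
  rewrite -[X in _ *+ X]card_ord -sumr_const ler_sum // => i _.
  by apply: ler_wiXn2l; [exact: ltW | exact: ltW | exact: ltnW].
have := @abel_bound _ chi k k_gt0 chi_le1 chi_per chi_sum0 (lambert_gap t) 1 X.+1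
  isT gap0 (fun n n0 => lambert_gap_decr s0 s1 n0).
have -> : lambert_gap t 1 = 1.
  by rewrite /lambert_gap mul1r expr1; field; rewrite lt0r_neq0.
have -> : \sum_(1 <= n < X.+1) chi n * lambert_gap t n = harmonic chi X / (1 - t)
   - \sum_(1 <= n < X.+1) chi n * (t ^+ n / (1 - t ^+ n)).
  rewrite /harmonic mulr_suml -sumrB; apply: eq_bigr => n _.
  by rewrite /lambert_gap mulrBr invfM mulrA.
move=> /ler_normlP[]; rewrite mulr1 => h1 _; have := lambert_truncate X t01 => h2.
have : J%:R * t ^+ (J ^ 2) <= \sum_(1 <= m < X.+1) divisor_sum chi m * t ^+ m.
  apply: le_trans (divisor_sum_squares t01 (leqnn J)) _.
  rewrite [leRHS](@big_cat_nat _ _ _ (J ^ 2).+1) //= lerDl.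
  rewrite big_nat_cond sumr_ge0 // => m /andP[/andP[jm _] _].
  by apply: divisor_sum_term_ge0 => //; exact: leq_ltn_trans (leq0n _) jm.
have : (2 * k + 2)%:R <= J%:R * t ^+ (J ^ 2).
  apply: le_trans (ler_wpM2l (ler0n _ _) tJ).
  by rewrite ler_pdivlMr // -natrM ler_nat.
move=> h3 h4.
have h5 : 2 - X%:R * t ^+ X / (1 - t) <= harmonic chi X / (1 - t).
  by move: h1 h2 h3 h4; rewrite natrD natrM; lra.
move: h5; rewrite -(ler_pM2r u0) mulrBl !divfK ?lt0r_neq0 //; lra.
Qed.

End Estimates.

(** * The von Mangoldt function *)

Section Mangoldt.
Variable R : realType.
Local Notation lnn n := (ln (n%:R : R)).

(** [primes n] lists the distinct prime factors, so it is a singleton exactly when n is a prime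
    power with positive exponent. *)
Definition mangoldt (n : nat) : R := if primes n is [:: p] then lnn p else 0.

Lemma lnn_ge0 n : 0 <= lnn n.
Proof.
by case: n => [|n]; [rewrite ln0 | rewrite ln_ge0 // ler1n].
Qed.

Lemma lnnM m n : (0 < m)%N -> (0 < n)%N -> lnn (m * n) = lnn m + lnn n.
Proof. by move=> m0 n0; rewrite natrM lnM // posrE ltr0n. Qed.

Lemma ler_lnn m n : (0 < m)%N -> (m <= n)%N -> lnn m <= lnn n.
Proof.
by move=> m0 mn; rewrite ler_ln ?ler_nat // posrE ltr0n // (leq_trans m0).
Qed.

Lemma ln2_le1 : lnn 2 <= 1.
Proof.
have -> : 2 = 1 + 1 :> R by lra.
by apply: le_ln1Dx; lra.
Qed.

Lemma ln2_ge_half : 2^-1 <= lnn 2.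
Proof.
have := @le_ln1Dx R (- 2^-1); rewrite (_ : 1 + - 2^-1 = 2^-1); last by lra.
by rewrite lnV ?posrE // => h; have := h _; lra.
Qed.

Lemma mangoldt_ge0 n : 0 <= mangoldt n.
Proof. by rewrite /mangoldt; case: primes => [|p []] //; apply: lnn_ge0. Qed.

Lemma mangoldt_pfactor p e : prime p -> mangoldt (p ^ e.+1) = lnn p.
Proof. by move=> pp; rewrite /mangoldt primesX // primes_prime. Qed.

Lemma mangoldt_neq0 n : mangoldt n != 0 ->
  exists p e, prime p /\ n = (p ^ e.+1)%N.
Proof.
rewrite /mangoldt; case En: (primes n) => [|p [|? ?]]; rewrite ?eqxx // => _.
have : p \in primes n by rewrite En inE.
rewrite mem_primes => /and3P[pp n0 pn]; exists p, (logn p n).-1; split=> //.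
rewrite prednK ?logn_gt0 ?En ?inE //.
rewrite {1}(prod_prime_decomp n0) prime_decompE En big_map /= big_seq1.
by [].
Qed.

(** Induction on n = p m: among the divisors of n that do not divide m, only p^(v+1) with v =
    [logn p m] is a prime power, and it contributes ln p. *)
Lemma sum_mangoldt n : (0 < n)%N ->
  \sum_(1 <= d < n.+1 | (d %| n)%N) mangoldt d = lnn n.
Proof.
elim/ltn_ind: n => n IH n0.
have [->|n1] : n = 1%N \/ (1 < n)%N by lia.
  by rewrite big_mkcond big_nat1 dvd1n ln1.
set p := pdiv n; have pp : prime p by apply: pdiv_prime.
have p1 := prime_gt1 pp.
have [m nE] : exists m, n = (p * m)%N.
  by have /dvdnP[m ->] := pdiv_dvd n; exists m; rewrite mulnC.
have m0 : (0 < m)%N by move: n0; rewrite nE muln_gt0 => /andP[].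
have mn : (m < n)%N by rewrite nE ltn_Pmull.
rewrite nE lnnM // ?(prime_gt0 pp) // -(IH m) // -nE.
rewrite (@sum_divisors_widen _ m n) ?m0 ?(ltnW mn) //.
rewrite (bigID (fun d => d %| m)%N) /= addrC; congr (_ + _); last first.
  apply: eq_bigl => d; apply/andb_idl => dm.
  by rewrite nE dvdn_mull.
set v := logn p m.
have vn : (0 < p ^ v.+1 < n.+1)%N.
  rewrite expn_gt0 (ltnW p1) ltnS dvdn_leq // pfactor_dvdn // nE lognM //.
    by rewrite logn_prime // eqxx.
  exact: prime_gt0.
have <- : \sum_(1 <= d < n.+1 | d == (p ^ v.+1)%N) lnn p = lnn p.
  by rewrite big_nat1_eq vn.
rewrite [LHS]big_mkcond [RHS]big_mkcond; apply: eq_bigr => d _.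
have [->|dE] := eqVneq d (p ^ v.+1)%N.
  rewrite mangoldt_pfactor // nE !pfactor_dvdn ?muln_gt0 ?(ltnW p1) //.
  by rewrite lognM ?(ltnW p1) // logn_prime // eqxx add1n leqnn ltnn.
have [->|/mangoldt_neq0[r [j [pr dj]]]] := eqVneq (mangoldt d) 0.
  by rewrite if_same.
case: ifP => //; rewrite dj nE !pfactor_dvdn ?muln_gt0 ?(ltnW p1) //.
rewrite lognM ?(ltnW p1) // logn_prime // -leqNgt.
case: eqVneq => [rp|_] /andP[h1 h2]; last by lia.
case/eqP: dE; rewrite dj rp; congr (_ ^ _)%N.
by move: h1 h2; rewrite rp /v; lia.
Qed.

Lemma sum_lnn x : \sum_(1 <= n < x.+1) lnn n
  = \sum_(1 <= d < x.+1) mangoldt d * (x %/ d)%:R.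
Proof.
transitivity (\sum_(1 <= n < x.+1) \sum_(1 <= d < n.+1 | (d %| n)%N) mangoldt d).
  by apply: eq_big_nat => n /andP[n0 _]; rewrite sum_mangoldt.
rewrite (sum_divisors_swap x (fun d e => mangoldt d)).
by apply: eq_bigr => d _; rewrite sumr_const_nat subn1 mulr_natr.
Qed.

(** The left side is the logarithm of the central binomial coefficient of 2m. Passing from m to m +
    1 adds at most 2 ln 2 <= 2. *)
Lemma sum_lnn_double m :
  \sum_(1 <= n < (2 * m).+1) lnn n - 2 * \sum_(1 <= n < m.+1) lnn n
  <= (2 * m)%:R.
Proof.
elim: m => [|m IH]; first by rewrite !big_geq // mulr0 subrr.
rewrite mulnS [in X in X - _]big_nat_recr //= [in X in X - _]big_nat_recr //=.
rewrite [in X in _ * X]big_nat_recr //=.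
have h1 : lnn (2 * m).+1 <= lnn (2 * m.+1) by rewrite ler_lnn //; lia.
have h2 : lnn (2 * m).+2 = lnn (2 * m.+1) by congr (lnn _); lia.
have h3 : lnn (2 * m.+1) = lnn 2 + lnn m.+1 by rewrite lnnM.
have := ln2_le1; move: IH h1; rewrite h2 h3 natrD; lra.
Qed.

Definition chebyshev x : R := \sum_(1 <= d < x.+1) mangoldt d.

(** In the logarithm of the central binomial coefficient, [mangoldt d] has coefficient floor(2m/d) -
    2 floor(m/d), which is never negative and is at least 1 for m < d <= 2m. *)
Lemma chebyshev_double m : chebyshev (2 * m) <= chebyshev m + (2 * m)%:R.
Proof.
have := sum_lnn_double m; rewrite !sum_lnn.
have m2 : (m <= 2 * m)%N by lia.
have -> : \sum_(1 <= d < m.+1) mangoldt d * (m %/ d)%:R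
   = \sum_(1 <= d < (2 * m).+1) mangoldt d * (m %/ d)%:R.
  rewrite [RHS](@big_cat_nat _ _ _ m.+1) //= [X in _ = _ + X]big_nat_cond.
  rewrite [X in _ = _ + X]big1 ?addr0 // => d /andP[/andP[md _] _].
  by rewrite divn_small // mulr0.
rewrite mulr_sumr -sumrB => /(le_trans _) h.
rewrite /chebyshev (@big_cat_nat _ _ _ m.+1) //= lerD2l; apply: h.
rewrite [leRHS](@big_cat_nat _ _ _ m.+1) //= -[leLHS]add0r lerD //.
  rewrite big_nat_cond sumr_ge0 // => d /andP[/andP[d0 _] _].
  rewrite mulrCA -mulrBr mulr_ge0 ?mangoldt_ge0 // subr_ge0 -natrM ler_nat.
  by rewrite leq_divRL // -mulnA leq_mul2l leq_divM orbT.
rewrite big_nat_cond [leRHS]big_nat_cond ler_sum // => d /andP[/andP[d0 dm] _].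
rewrite (divn_small d0) !mulr0 subr0 ler_peMr ?mangoldt_ge0 //.
by rewrite ler1n divn_gt0 // (leq_ltn_trans _ d0).
Qed.

Lemma chebyshev_mono m n : (m <= n)%N -> chebyshev m <= chebyshev n.
Proof.
move=> mn; rewrite /chebyshev [leRHS](@big_cat_nat _ _ _ m.+1) //= lerDl.
by rewrite sumr_ge0 // => d _; apply: mangoldt_ge0.
Qed.

Lemma chebyshev_bound x : chebyshev x <= 4 * x%:R.
Proof.
elim/ltn_ind: x => x IH.
have [x3|x3] := leqP 3 x.
  (* Here m = ceil(x/2). The recursion yields 4m + 2m = 6m, which is at most 4x only from x = 3 on;
     smaller x are the base cases. *)
  have [m [x2m xm mx]] : exists m, [/\ (x <= 2 * m)%N, (m < x)%N & (6 * m <= 4 * x)%N].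
    by exists (x.+1 %/ 2)%N; split; lia.
  apply: le_trans (chebyshev_mono x2m) (le_trans (chebyshev_double m) _).
  have := IH m xm.
  have : (6 * m)%:R <= (4 * x)%:R :> R by rewrite ler_nat.
  by rewrite !natrM; lra.
rewrite /chebyshev; have p2 : mangoldt 2 = lnn 2 by rewrite (@mangoldt_pfactor 2 0).
have p1 : mangoldt 1 = 0 by [].
have := ln2_le1; case: x x3 {IH} => [|[|[|]]] // _.
- by rewrite big_geq // mulr0.
- by rewrite big_nat1 p1; lra.
- by rewrite big_ltn // big_nat1 p1 p2; lra.
Qed.

End Mangoldt.

(** * Primes with prescribed real characters *)

Lemma coprime_mul_mod_inj (a k m n : nat) : coprime a k ->
  (m < k)%N -> (n < k)%N -> (a * m = a * n %[mod k])%N -> m = n.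
Proof.
wlog mn : m n / (m <= n)%N.
  move=> H ak mk nk E; have [le|/ltnW le] := leqP m n; first exact: H.
  by apply/esym; apply: H.
move=> ak mk nk /esym/eqP; rewrite eqn_mod_dvd ?leq_mul2l ?mn ?orbT //.
rewrite -mulnBr Gauss_dvdr 1?coprime_sym // => /dvdnP[q qE].
case: q qE => [|q] qE; first lia.
suff : (k <= n - m)%N by lia.
by rewrite qE leq_pmull.
Qed.

Section MangoldtCharacter.
Variable R : realType.
Local Notation lnn n := (ln (n%:R : R)).

Section NonPrincipal.
Variables (chi : nat -> R) (k : nat).
Hypothesis chiM : forall m n, chi (m * n)%N = chi m * chi n.
Hypothesis chi1 : chi 1 = 1.
Hypothesis chi_val : forall n, [|| chi n == 0, chi n == 1 | chi n == -1].
Hypothesis k_gt0 : (0 < k)%N.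
Hypothesis chi_per : forall n, chi (n + k)%N = chi n.
Hypothesis chi_sum0 : \sum_(0 <= n < k) chi n = 0.

Let chi_le1 := chi_le1 chi_val.

(** Since ln(1 + 1/n) <= 1/n, the condition ln n >= 1 suffices. Starting at 4 = 2^2 derives it from
    ln 2 >= 1/2. *)
Lemma lnn_div_decr n : (4 <= n)%N -> lnn n.+1 / n.+1%:R <= lnn n / n%:R.
Proof.
move=> n4; have n0 : 0 < n%:R :> R by rewrite ltr0n; lia.
rewrite ler_pdivrMr // mulrAC ler_pdivlMr //.
have -> : n.+1%:R = n%:R * (1 + n%:R^-1) :> R.
  by rewrite mulrDr mulfV ?lt0r_neq0 // mulr1 natr1.
have i0 : 0 < n%:R^-1 :> R by rewrite invr_gt0.
rewrite lnM ?posrE //; last by lra.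
have h1 : ln (1 + n%:R^-1 : R) <= n%:R^-1 by apply: le_ln1Dx; lra.
have h2 : 1 <= lnn n.
  apply: (@le_trans _ _ (lnn (2 * 2))); last by apply: ler_lnn.
  by rewrite lnnM //; have := ln2_ge_half R; lra.
have := ler_wpM2r (ltW n0) h1; rewrite mulVf ?lt0r_neq0 // mulrDr mulrDl => h3.
by rewrite mulr1 mulfV ?lt0r_neq0 // mulrDr mulr1; lra.
Qed.

Lemma chi_ln_bounded : exists C, forall x, (4 <= x)%N ->
  `|\sum_(1 <= n < x.+1) chi n * (lnn n / n%:R)| <= C.
Proof.
exists (`|\sum_(1 <= n < 4) chi n * (lnn n / n%:R)| + 2 * k%:R * (lnn 4 / 4)).
move=> x x4; rewrite (@big_cat_nat _ _ _ 4) //=; last by lia.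
apply: le_trans (ler_normD _ _) _; rewrite lerD2l.
apply: (@abel_bound _ chi k k_gt0 chi_le1 chi_per chi_sum0 (fun n => lnn n / n%:R)).
- by lia.
- by move=> n _; rewrite divr_ge0 // lnn_ge0.
- exact: lnn_div_decr.
Qed.

(** The truncated form of -L' = (-L'/L) L at s = 1. *)
Lemma chi_ln_mangoldt x : \sum_(1 <= n < x.+1) chi n * (lnn n / n%:R)
  = \sum_(1 <= d < x.+1) chi d * mangoldt R d / d%:R * harmonic chi (x %/ d).
Proof.
transitivity (\sum_(1 <= n < x.+1) \sum_(1 <= d < n.+1 | (d %| n)%N)
   (chi d * mangoldt R d / d%:R * (chi (n %/ d)%N / (n %/ d)%:R))).
  apply: eq_big_nat => n /andP[n0 _].
  rewrite -(sum_mangoldt R n0) mulr_suml mulr_sumr; apply: eq_bigr => d dn.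
  rewrite -[in chi n](divnK dn) -[in n%:R](divnK dn) chiM natrM invfM; ring.
rewrite (sum_divisors_swap x
  (fun d e => chi d * mangoldt R d / d%:R * (chi e / e%:R))).
by apply: eq_bigr => d _; rewrite /harmonic mulr_sumr.
Qed.

(** Replace [harmonic chi (x %/ d)] by [harmonic chi x] in the convolution. By [harmonic_tail] the
    error for d is at most [mangoldt d] times 2k/x, in total 8k by Chebyshev's bound 4x. Dividing by
    [harmonic chi x] is then possible because it stays above c > 0. *)
Lemma chi_mangoldt_bounded : exists C X0, forall x, (X0 <= x)%N ->
  `|\sum_(1 <= d < x.+1) chi d * mangoldt R d / d%:R| <= C.
Proof.
have [C hC] := chi_ln_bounded.
have [c [X0 [c0 hc]]] :=
  harmonic_lower_bound chiM chi1 chi_val k_gt0 chi_per chi_sum0.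
exists ((C + 8 * k%:R) / c), (maxn X0 4) => x; rewrite geq_max => /andP[x0 x4].
have hx := hc _ x0; have := hC _ x4; rewrite chi_ln_mangoldt.
set S := \sum_(1 <= d < x.+1) _ => hS.
set T := \sum_(1 <= d < x.+1) _.
have x_gt0 : 0 < x%:R :> R by rewrite ltr0n; lia.
have hST : `|S - T * harmonic chi x| <= 8 * k%:R.
  rewrite /S /T mulr_suml -sumrB.
  apply: (@le_trans _ _ (\sum_(1 <= d < x.+1) mangoldt R d * (2 * k%:R / x%:R))).
    apply: le_trans (ler_norm_sum _ _ _) _.
    rewrite big_nat_cond [leRHS]big_nat_cond ler_sum // => d /andP[/andP[d0 dx] _].
    have d_gt0 : 0 < d%:R :> R by rewrite ltr0n.
    rewrite -mulrBr normrM -mulrA normrM [`|mangoldt R d / d%:R|]ger0_norm; last first.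
      by rewrite divr_ge0 ?mangoldt_ge0.
    have -> : `|chi d| * (mangoldt R d / d%:R) *
        `|harmonic chi (x %/ d) - harmonic chi x| = mangoldt R d *
        (`|chi d| * (d%:R^-1 * `|harmonic chi (x %/ d) - harmonic chi x|)) by ring.
    rewrite ler_wpM2l ?mangoldt_ge0 //.
    have := @harmonic_tail _ chi k k_gt0 chi_le1 chi_per chi_sum0
      (x %/ d)%N x (leq_div _ _).
    rewrite distrC => ht.
    have t0 : 0 <= `|harmonic chi (x %/ d) - harmonic chi x| by [].
    apply: (@le_trans _ _ (d%:R^-1 * (2 * k%:R / (x %/ d).+1%:R))).
      rewrite -[leRHS]mul1r ler_pM ?mulr_ge0 ?invr_ge0 //.
      by rewrite ler_wpM2l // invr_ge0.
    rewrite mulrCA ler_wpM2l ?mulr_ge0 // -invfM lef_pV2 ?posrE ?mulr_gt0 //.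
    by rewrite -natrM ler_nat mulnC ltnW // ltn_ceil.
  rewrite -mulr_suml mulrA ler_pdivrMr //.
  have k2 : 0 <= 2 * k%:R :> R by rewrite mulr_ge0.
  by have := ler_wpM2r k2 (chebyshev_bound R x); rewrite /chebyshev; lra.
have Hp : 0 < harmonic chi x by lra.
rewrite ler_pdivlMr //.
apply: (@le_trans _ _ (`|T * harmonic chi x|)).
  by rewrite normrM [X in _ <= _ * X]ger0_norm ?(ltW Hp) // ler_wpM2l.
have -> : T * harmonic chi x = S - (S - T * harmonic chi x) by ring.
by apply: le_trans (ler_normB _ _) _; apply: lerD.
Qed.

End NonPrincipal.

(** * Divergence for the principal character *)

Section Principal.
Variable k : nat.
Hypothesis k_gt0 : (0 < k)%N.

(** Only m terms with n = 1 mod k are kept, each at least ln y; this avoids counting the integers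
    coprime to k. *)
Lemma coprime_ln_lower y m : (0 < y)%N -> m%:R * lnn y <=
  \sum_(1 <= n < (1 + (y + m) * k).+1) (coprime n k)%:R * lnn n.
Proof.
have t0 n : 0 <= (coprime n k)%:R * lnn n by rewrite mulr_ge0 ?lnn_ge0.
move=> y0; elim: m => [|m IH]; first by rewrite mul0r sumr_ge0.
rewrite (@big_cat_nat _ _ _ (1 + (y + m) * k).+1) //=; last first.
  by rewrite ltnS leq_add2l leq_mul2r addnS leqnSn orbT.
rewrite -natr1 mulrDl mul1r lerD // big_nat_recr /=; last first.
  by rewrite ltn_add2l ltn_mul2r k_gt0 addnS ltnSn.
rewrite -[leLHS]add0r lerD ?sumr_ge0 //.
have -> : coprime (1 + (y + m.+1) * k) k.
  by rewrite coprime_sym [(1 + _)%N]addnC /coprime gcdnMDl gcdn1.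
by rewrite mul1r ler_lnn // addnS mulSn; nia.
Qed.

(** The sum of ln n over n <= x coprime to k is at least y ln y, and unfolding ln n over the
    divisors of n bounds it by x times the sum in question. As x <= 3ky, that sum is at least ln
    y/(3k). *)
Lemma coprime_mangoldt_unbounded (B : R) (X0 : nat) : exists2 x, (X0 <= x)%N &
  B <= \sum_(1 <= d < x.+1) (coprime d k)%:R * mangoldt R d / d%:R.
Proof.
(* The target is ln y >= 3kB; ln 2 >= 1/2 turns 3 into 6. The summand X0 in the exponent makes x >=
   X0. *)
pose b := Num.bound `|6 * k%:R * B|; pose y := (2 ^ (b + X0))%N.
have y0 : (0 < y)%N by rewrite expn_gt0.
have lny : 3 * k%:R * B <= lnn y.
  rewrite /y natrX lnXn // -[_ *+ (b + X0)]mulr_natl.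
  have := archi_boundP (normr_ge0 (6 * k%:R * B)); rewrite -/b => h1.
  have h3 := ler_norm (6 * k%:R * B).
  have h2 : b%:R <= (b + X0)%:R :> R by rewrite ler_nat leq_addr.
  have := ler_wpM2l (ler0n R (b + X0)) (ln2_ge_half R); lra.
pose x := (1 + (y + y) * k)%N.
have yx : (y <= x)%N by rewrite /x; nia.
have x3 : (x <= 3 * k * y)%N by rewrite /x; nia.
exists x.
  apply: leq_trans yx; apply: leq_trans (ltnW (ltn_expl (b + X0) (isT : 1 < 2)%N)).
  exact: leq_addl.
have x0 : 0 < x%:R :> R by [].
have := coprime_ln_lower y y0; rewrite -/x.
have -> : \sum_(1 <= n < x.+1) (coprime n k)%:R * lnn n =
  \sum_(1 <= n < x.+1) \sum_(1 <= d < n.+1 | (d %| n)%N)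
   ((coprime d k)%:R * mangoldt R d * (coprime (n %/ d) k)%:R).
  apply: eq_big_nat => n /andP[n0 _].
  rewrite -(sum_mangoldt R n0) mulr_sumr; apply: eq_bigr => d dn.
  by rewrite -{1}(divnK dn) coprimeMl -mulnb natrM; ring.
rewrite (sum_divisors_swap x
  (fun d e => (coprime d k)%:R * mangoldt R d * (coprime e k)%:R)) => h.
have {}h : y%:R * lnn y <=
    x%:R * \sum_(1 <= d < x.+1) (coprime d k)%:R * mangoldt R d / d%:R.
  apply: le_trans h _; rewrite mulr_sumr.
  rewrite big_nat_cond [leRHS]big_nat_cond ler_sum // => d /andP[/andP[d0 dx] _].
  have d_gt0 : 0 < d%:R :> R by rewrite ltr0n.
  rewrite -mulr_sumr mulrCA ler_wpM2l ?mulr_ge0 ?mangoldt_ge0 //.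
  apply: (@le_trans _ _ (\sum_(1 <= e < (x %/ d).+1) 1)).
    by apply: ler_sum => e _; rewrite lern1 leq_b1.
  rewrite sumr_const_nat subn1 ler_pdivlMr // -natrM ler_nat.
  exact: leq_divM.
rewrite leNgt; apply/negP => hB.
have y0' : 0 < y%:R :> R by rewrite ltr0n.
have := ler_wpM2l (ltW y0') lny.
have := hB; rewrite -(ltr_pM2l x0).
have xk : x%:R <= 3 * k%:R * y%:R :> R by rewrite -!natrM ler_nat.
have [B0|B0] := leP 0 B.
  have := ler_wpM2r B0 xk; lra.
have : 0 <= \sum_(1 <= d < x.+1) (coprime d k)%:R * mangoldt R d / d%:R.
  by rewrite sumr_ge0 // => d _; rewrite divr_ge0 ?mulr_ge0 ?mangoldt_ge0.
lra.
Qed.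

End Principal.

(* Weighting by [\prod_i (1 + e i * c i n)] selects the [n] with [c i n = e i]
   for all [i]; expanding it, only the empty product has an unbounded sum. *)
Theorem character_pattern (I : finType) (k : nat) (c : I -> nat -> R)
  (e : I -> R) :
  (0 < k)%N ->
  (forall i m n, c i (m * n)%N = c i m * c i n) ->
  (forall i n, c i (n + k)%N = c i n) ->
  (forall i n, coprime n k -> c i n = 1 \/ c i n = -1) ->
  (forall i, exists a, [/\ coprime a k, c i a = -1 & forall j, j != i -> c j a = 1]) ->
  (forall i, e i = 1 \/ e i = -1) ->
  exists p f, [/\ prime p, coprime p k & forall i, c i (p ^ f.+1)%N = e i].
Proof.
move=> k0 cM cper cval dual eval.
pose chi (S : {set I}) n : R := (coprime n k)%:R * \prod_(i in S) c i n.
have chiM S m n : chi S (m * n)%N = chi S m * chi S n.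
  rewrite /chi coprimeMl -mulnb natrM mulrACA -big_split /=.
  by congr (_ * _); apply: eq_bigr.
have cpv i n : coprime n k -> c i n * c i n = 1.
  by move=> /(cval i)[] ->; rewrite ?mulrNN mulr1.
have c1 i : c i 1%N = 1.
  by rewrite -(cpv i _ (coprime1n k)) -cM.
have chi1 S : chi S 1%N = 1.
  by rewrite /chi coprime1n mul1r big1.
have prod_val (S : {set I}) n : coprime n k ->
    \prod_(i in S) c i n = 1 \/ \prod_(i in S) c i n = -1.
  move=> nk; apply: (big_ind (fun x : R => x = 1 \/ x = -1)); first by left.
    by move=> x y [] -> [] ->; rewrite ?mulrNN ?mul1r ?mulr1; auto.
  by move=> i _; apply: cval.
have chi_val S n : [|| chi S n == 0, chi S n == 1 | chi S n == -1].
  rewrite /chi; case: (boolP (coprime n k)) => nk; last by rewrite mul0r eqxx.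
  by rewrite mul1r; case: (prod_val S n nk) => ->; rewrite eqxx ?orbT.
have chi_per S n : chi S (n + k)%N = chi S n.
  rewrite /chi; congr (_ * _); last by apply: eq_bigr.
  by rewrite /coprime gcdnC gcdnDr gcdnC.
(* Multiplication by the element a dual to some i in S permutes the residues modulo k and changes
   the sign of [chi S]. *)
have chi_sum0 (S : {set I}) : S != set0 -> \sum_(0 <= n < k) chi S n = 0.
  case/set0Pn => i iS; have [a [ak ai aj]] := dual i.
  have chia : chi S a = -1.
    rewrite /chi ak mul1r (bigD1 i) //= ai big1 ?mulr1 // => j /andP[_ ji].
    exact: aj.
  have k1 : (k.-1.+1 = k)%N by rewrite prednK.
  have sumE : \sum_(0 <= n < k) chi S n = \sum_(n < k) chi S n by rewrite big_mkord.
  have chimod n : chi S (n %% k)%N = chi S n.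
    rewrite {2}(divn_eq n k) addnC; elim: (n %/ k)%N => [|q IH].
      by rewrite mul0n addn0.
    by rewrite mulSn addnCA addnC chi_per.
  pose h (n : 'I_k) : 'I_k := Ordinal (ltn_pmod (a * n) k0).
  have h_inj : injective h.
    move=> m n /(congr1 val) /= mn; apply: val_inj.
    exact: coprime_mul_mod_inj mn.
  have : \sum_(n < k) chi S n = - \sum_(n < k) chi S n.
    rewrite {1}(reindex_inj h_inj) /= -sumrN; apply: eq_bigr => n _.
    by rewrite chimod chiM chia mulN1r.
  by rewrite sumE; lra.
pose T (S : {set I}) x := \sum_(1 <= d < x.+1) chi S d * mangoldt R d / d%:R.
have /fin_all_exists[CX hCX] : forall S, exists CX : R * nat,
    S != set0 -> forall x, (CX.2 <= x)%N -> `|T S x| <= CX.1.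
  move=> S; have [->|S0] := eqVneq S set0; first by exists (0, 0%N).
  have [C [X0 h]] := chi_mangoldt_bounded (chiM S) (chi1 S) (chi_val S) k0
    (chi_per S) (chi_sum0 S S0).
  by exists (C, X0).
(* The principal sum exceeds the total of all other bounds by at least 1, so the weighted sum is
   positive; the maximum makes x admissible for every S. *)
have [x xX hx] := coprime_mangoldt_unbounded k0
  (1 + \sum_(S : {set I} | S != set0) (CX S).1) (\max_(S : {set I}) (CX S).2).
pose W n := (coprime n k)%:R * mangoldt R n / n%:R * \prod_i (e i * c i n + 1).
have WE : \sum_(1 <= n < x.+1) W n = \sum_(S : {set I}) (\prod_(i in S) e i) * T S x.
  transitivity (\sum_(1 <= n < x.+1) \sum_(S : {set I})
     (\prod_(i in S) e i) * (chi S n * mangoldt R n / n%:R)).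
    apply: eq_bigr => n _; rewrite /W bigA_distr mulr_sumr; apply: eq_bigr => S _.
    by rewrite -big_mkcond big_split /= /chi; ring.
  by rewrite exchange_big; apply: eq_bigr => S _; rewrite mulr_sumr.
have Wpos : 0 < \sum_(1 <= n < x.+1) W n.
  rewrite WE (bigD1 set0) //= big_set0 mul1r.
  have -> : T set0 x = \sum_(1 <= d < x.+1) (coprime d k)%:R * mangoldt R d / d%:R.
    by apply: eq_bigr => d _; rewrite /chi big_set0 mulr1.
  suff : `|\sum_(S : {set I} | S != set0) (\prod_(i in S) e i) * T S x|
      <= \sum_(S : {set I} | S != set0) (CX S).1.
    by move=> /ler_normlP[]; move: hx; lra.
  apply: le_trans (ler_norm_sum _ _ _) (ler_sum _ _) => S S0.
  have -> : `|(\prod_(i in S) e i) * T S x| = `|T S x|.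
    rewrite normrM normr_prod big1 ?mul1r // => i _.
    by case: (eval i) => ->; rewrite ?normrN normr1.
  apply: hCX => //; apply: leq_trans xX; exact: (leq_bigmax S).
have [n Wn] : exists n, W n != 0.
  have [[n _ Wn]|none] := altP (@hasP _ (fun n => W n != 0) (index_iota 1 x.+1)).
    by exists n.
  move: Wpos; rewrite big_seq big1 ?ltxx // => n nx.
  by move/hasPn: none => /(_ n nx); rewrite negbK => /eqP.
(* A nonzero weight says that n is coprime to k, is a prime power, and has e i * c i n different
   from -1, hence c i n = e i, for all i. *)
move: Wn; rewrite /W !mulf_eq0 !negb_or -!andbA => /and4P[nk Ln _].
have {nk} nk : coprime n k by move: nk; case: coprime; rewrite ?eqxx.
rewrite prodf_seq_neq0 => /allP hprod.
have [p [f [pp nE]]] := mangoldt_neq0 Ln.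
exists p, f; split=> //; first by move: nk; rewrite nE coprime_pexpl.
move=> i; have := hprod i; rewrite mem_index_enum -nE => /(_ isT) /=.
by case: (cval i n nk) (eval i) => -> [] ->; rewrite ?mulrNN ?mulr1 ?mul1r // addNr eqxx.
Qed.

End MangoldtCharacter.

(** * Quadratic reciprocity *)

Lemma pchar_int_eq0 (R : nzRingType) (q : nat) (m : int) : q \in [pchar R] ->
  (m%:~R == 0 :> R) = (q %| `|m|)%N.
Proof.
move=> qR; case: m => n; first by rewrite (dvdn_pcharf qR).
by rewrite NegzE mulrNz oppr_eq0 abszN (dvdn_pcharf qR).
Qed.

Definition is_sign3 (a : int) := [|| a == 0, a == 1 | a == -1].

(** Two such integers differ by at most 2 < q, so symbols can be compared inside any ring of
    characteristic q. *)
Lemma sign3_inj (R : nzRingType) (q : nat) (a b : int) :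
  q \in [pchar R] -> (2 < q)%N -> is_sign3 a -> is_sign3 b ->
  a%:~R = b%:~R :> R -> a = b.
Proof.
move=> qR q2 ha hb /eqP; rewrite -subr_eq0 -rmorphB /= (pchar_int_eq0 _ qR) => h.
have ab : (`|a - b| <= 2)%N.
  by case/or3P: ha => /eqP->; case/or3P: hb => /eqP->.
case: (posnP `|a - b|) => [/eqP|ab0]; first by rewrite absz_eq0 subr_eq0 => /eqP.
by have := dvdn_leq ab0 h; lia.
Qed.

Section Legendre.
Variable p : nat.
Hypothesis p_prime : prime p.
Hypothesis p_odd : (2 < p)%N.

(** Defined by Euler's criterion, from which multiplicativity follows at once; the link with squares
    is [quad_char_eq1]. *)
Definition quad_char (x : 'F_p) : int :=
  if x == 0 then 0 else if x ^+ p.-1./2 == 1 then 1 else -1.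

Lemma quad_char_sign3 x : is_sign3 (quad_char x).
Proof. by rewrite /quad_char; case: ifP => // _; case: ifP. Qed.

Lemma half_pred_double : (p.-1./2).*2 = p.-1.
Proof. by have := odd_prime_gt2; case: (even_prime p_prime) => // [|]; lia. Qed.

Lemma Fp_expf_pred (x : 'F_p) : x != 0 -> x ^+ p.-1 = 1.
Proof.
move=> x0; apply: (mulfI x0); rewrite mulr1 -exprS prednK ?prime_gt0 //.
by rewrite -{2}[x]expf_card card_Fp.
Qed.

Lemma euler_criterion x : (quad_char x)%:~R = x ^+ p.-1./2 :> 'F_p.
Proof.
have h0 : (0 < p.-1./2)%N by have := half_pred_double; lia.
rewrite /quad_char; case: eqVneq => [->|x0]; first by rewrite expr0n eqn0Ngt h0.
case: eqVneq => [->//|x1].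
have : (x ^+ p.-1./2) ^+ 2 == 1.
  by rewrite -exprM muln2 half_pred_double Fp_expf_pred.
by rewrite sqrf_eq1 (negbTE x1) => /eqP->.
Qed.

Lemma quad_charM x y : quad_char (x * y) = quad_char x * quad_char y.
Proof.
apply: (sign3_inj (pchar_Fp p_prime) p_odd).
- exact: quad_char_sign3.
- by case/or3P: (quad_char_sign3 x) => /eqP->; case/or3P: (quad_char_sign3 y) => /eqP->.
- by rewrite rmorphM /= !euler_criterion exprMn.
Qed.

Lemma quad_char0 : quad_char 0 = 0. Proof. by rewrite /quad_char eqxx. Qed.

Lemma quad_char1 : quad_char 1 = 1.
Proof. by rewrite /quad_char oner_eq0 expr1n eqxx. Qed.

Lemma quad_char_unit x : x != 0 -> quad_char x = 1 \/ quad_char x = -1.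
Proof. by rewrite /quad_char => /negbTE->; case: ifP; auto. Qed.

Lemma Fp_generator : exists g : 'F_p, [/\ g != 0,
  (forall n, (g ^+ n == 1) = (p.-1 %| n)%N) & forall x, x != 0 -> exists n, x = g ^+ n].
Proof.
have /cyclicP[u uE] := field_unit_group_cyclic [set: {unit 'F_p}].
have ou : #[u]%g = p.-1 by rewrite orderE -uE card_finField_unit card_Fp.
exists (FinRing.uval u); split.
- by rewrite -unitfE; exact: valP u.
- by move=> n; rewrite -ou order_dvdn -FinRing.val_unitX -(inj_eq val_inj).
- move=> x; rewrite -unitfE => xu.
  have : FinRing.unit 'F_p xu \in <[u]>%g by rewrite -uE inE.
  case/cycleP=> n nE; exists n.
  by rewrite -FinRing.val_unitX -nE.
Qed.

Lemma quad_char_eq1 x : quad_char x = 1 -> exists y, x = y ^+ 2.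
Proof.
have [->|x0] := eqVneq x 0; first by rewrite quad_char0.
have [g [g0 ord gen]] := Fp_generator; have [n ->] := gen x x0 => h.
have : (g ^+ n) ^+ p.-1./2 == 1 by rewrite -euler_criterion h.
have hE : p.-1 = (2 * p.-1./2)%N by rewrite mul2n half_pred_double.
rewrite -exprM ord {1}hE dvdn_pmul2r; last by move: hE; lia.
by case/dvdnP=> m ->; exists (g ^+ m); rewrite -exprM.
Qed.

Lemma quad_char_nonresidue : exists x, quad_char x = -1.
Proof.
have [g [g0 ord _]] := Fp_generator; exists g.
rewrite /quad_char (negbTE g0) ord; case: ifP => // /dvdn_leq.
by have := half_pred_double; lia.
Qed.

Lemma sum_quad_char : \sum_x quad_char x = 0.
Proof.
have [g gN] := quad_char_nonresidue.
have g0 : g != 0 by apply/eqP => g0; move: gN; rewrite g0 quad_char0.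
have : \sum_x quad_char x = - \sum_x quad_char x.
  rewrite {1}(reindex_inj (mulfI g0)) /= -sumrN; apply: eq_bigr => x _.
  by rewrite quad_charM gN mulN1r.
lia.
Qed.

End Legendre.

Lemma euler_criterion_pchar (L : nzRingType) (q : nat) (m : int) :
  prime q -> (2 < q)%N -> q \in [pchar L] ->
  (m%:~R : L) ^+ q.-1./2 = (quad_char (m%:~R : 'F_q))%:~R.
Proof.
move=> qp q2 qL; apply/eqP; rewrite -subr_eq0 -rmorphXn -rmorphB /=.
rewrite (pchar_int_eq0 _ qL) -(pchar_int_eq0 _ (pchar_Fp qp)).
by rewrite rmorphB rmorphXn /= euler_criterion // subrr.
Qed.

(** * Gauss sums in characteristic q *)

Section GaussSum.
Variables p q : nat.
Hypotheses (p_prime : prime p) (p_odd : (2 < p)%N).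
Hypotheses (q_prime : prime q) (q_odd : (2 < q)%N) (pq : p != q).
Variables (L : fieldType) (z : L).
Hypotheses (qL : q \in [pchar L]) (zp : z ^+ p = 1) (z1 : z != 1).

Local Notation chi := (@quad_char p).
Definition Fp_exp (x : 'F_p) : L := z ^+ x.
Local Notation ee := Fp_exp.

Lemma exp_Fp_nat n : ee n%:R = z ^+ n.
Proof. by rewrite /ee val_Fp_nat // expr_mod. Qed.

Lemma exp_FpD (a b : 'F_p) : ee (a + b) = ee a * ee b.
Proof. by rewrite -[a in LHS]natr_Zp -[b in LHS]natr_Zp -natrD exp_Fp_nat exprD. Qed.

Lemma exp_FpMn (a : 'F_p) n : ee (n%:R * a) = ee a ^+ n.
Proof. by rewrite -[a in LHS]natr_Zp -natrM exp_Fp_nat mulnC exprM. Qed.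

Lemma sum_exp_Fp (u : 'F_p) : u != 0 -> \sum_a ee (a * u) = 0.
Proof.
move=> u0; have <- : \sum_a ee a = \sum_a ee (a * u) by rewrite (reindex_inj (mulIf u0)).
have : (\sum_a ee a) * z = \sum_a ee a.
  rewrite [RHS](reindex_inj (addIr 1)) mulr_suml; apply: eq_bigr => a _.
  by rewrite exp_FpD -[1]/(1%:R) exp_Fp_nat expr1.
move/eqP; rewrite -subr_eq0 -{2}[\sum_a _]mulr1 -mulrBr mulf_eq0 subr_eq0.
by rewrite (negbTE z1) orbF => /eqP.
Qed.

Definition gauss_sum : L := \sum_a (chi a)%:~R * ee a.

(** Substitute b = a c in the double sum, using chi(a)^2 = 1. The inner sum over a != 0 is p - 1 for
    c = -1 and -1 otherwise; the terms -1 cancel because chi sums to 0. *)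
Lemma gauss_sum_sqr : gauss_sum ^+ 2 = (chi (-1) * p%:Z)%:~R.
Proof.
have -> : gauss_sum ^+ 2 =
    \sum_(a | a != 0) \sum_c (chi c)%:~R * ee (a * (1 + c)).
  rewrite expr2 {1}/gauss_sum (bigD1 0) //= quad_char0 mul0r add0r mulr_suml.
  apply: eq_bigr => a a0; rewrite /gauss_sum mulr_sumr.
  rewrite (reindex_inj (mulfI a0)) /=; apply: eq_bigr => c _.
  rewrite mulrACA -exp_FpD -rmorphM /= mulrDr mulr1 quad_charM // mulrA.
  by case: (quad_char_unit a0) => ->; rewrite ?mulrNN !mul1r.
rewrite exchange_big /=.
have inner (c : 'F_p) : \sum_(a | a != 0) (chi c)%:~R * ee (a * (1 + c)) =
    (chi c)%:~R * ((p%:Z * (c == -1)%:R) - 1)%:~R :> L.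
  rewrite -mulr_sumr; congr (_ * _).
  have [->|c1] := eqVneq c (-1).
    rewrite subrr mulr1.
    have -> : \sum_(a : 'F_p | a != 0) ee (a * 0) = \sum_(a : 'F_p | a != 0) 1.
      by apply: eq_bigr => a _; rewrite mulr0 /Fp_exp expr0.
    rewrite sumr_const (eq_card (B := predC1 (0 : 'F_p))) // cardC1 card_Fp //.
    by rewrite -subn1 natrB ?prime_gt0 // rmorphB.
  have u0 : 1 + c != 0 by rewrite addrC addr_eq0.
  have := sum_exp_Fp u0; rewrite (bigD1 0) //= mul0r [Fp_exp 0]expr0 => /eqP.
  by rewrite mulr0 sub0r addrC addr_eq0 => /eqP->; rewrite rmorphN.
under eq_bigr => c _ do rewrite inner -rmorphM /= mulrBr mulr1.
rewrite -rmorph_sum /= sumrB sum_quad_char // subr0 (bigD1 (-1)) //= eqxx mulr1.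
rewrite big1 ?addr0 // => c /negbTE->; by rewrite !mulr0.
Qed.

(** The q-th power is additive in characteristic q; it fixes the integer values of chi and sends
    [ee a] to [ee (q a)]. *)
Lemma gauss_sum_frobenius : gauss_sum ^+ q = (chi q%:R)%:~R * gauss_sum.
Proof.
have qF : (q%:R : 'F_p) != 0.
  by rewrite -(dvdn_pcharf (pchar_Fp p_prime)) dvdn_prime2.
rewrite -(pFrobenius_autE qL) /gauss_sum rmorph_sum /=.
rewrite [in RHS](reindex_inj (mulfI qF)) mulr_sumr; apply: eq_bigr => a _ /=.
rewrite rmorphM /= pFrobenius_aut_int pFrobenius_autE exp_FpMn mulrA -rmorphM /=.
congr (_ %:~R * _); rewrite quad_charM // mulrA.
by case: (quad_char_unit qF) => ->; rewrite ?mulrNN !mul1r.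
Qed.

(** Compute g^q for the Gauss sum g in two ways: by Frobenius, and as g times the (q-1)/2-th power
    of g^2, to which Euler's criterion applies. Then cancel g, nonzero since p is invertible modulo
    q. *)
Lemma gauss_sum_reciprocity :
  @quad_char q (chi (-1) * p%:Z)%:~R = chi q%:R.
Proof.
have pF : (p%:R : 'F_q) != 0.
  by rewrite -(dvdn_pcharf (pchar_Fp q_prime)) dvdn_prime2 // eq_sym.
have g0 : gauss_sum != 0.
  apply/eqP => g0; have := gauss_sum_sqr; rewrite g0 expr0n /= => /esym/eqP.
  rewrite (pchar_int_eq0 _ qL) abszM -[`|p|%N]/p.
  have N1 : (-1 : 'F_p) != 0 by rewrite oppr_eq0 oner_eq0.
  case: (quad_char_unit N1) => -> /=; rewrite mul1n dvdn_prime2 // eq_sym.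
    by rewrite (negbTE pq).
  by rewrite (negbTE pq).
apply: (sign3_inj qL q_odd); try exact: quad_char_sign3.
apply: (mulIf g0); rewrite -gauss_sum_frobenius -euler_criterion_pchar //.
rewrite -gauss_sum_sqr -exprM mul2n half_pred_double // -exprSr prednK //.
exact: prime_gt0.
Qed.

End GaussSum.

Lemma finField_root_order (p k n : nat) : prime p -> (0 < k)%N ->
  (n %| (p ^ k).-1)%N -> exists (L : finFieldType) (z : L),
  p \in [pchar L] /\ (forall m, (z ^+ m == 1) = (n %| m)%N).
Proof.
move=> pp k0 nd; have [L pL cL] := pPrimePowerField pp k0.
have /cyclicP[u uE] := field_unit_group_cyclic [set: {unit L}].
have ou : #[u]%g = (p ^ k).-1 by rewrite orderE -uE card_finField_unit cL.
have pk0 : (0 < (p ^ k).-1)%N.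
  by rewrite -subn1 subn_gt0 -(expn0 p) ltn_exp2l // prime_gt1.
have [d dE] := dvdnP nd.
have d0 : (0 < d)%N by move: pk0; rewrite dE muln_gt0 => /andP[].
exists L, (FinRing.uval (u ^+ d)%g); split=> // m.
rewrite -FinRing.val_unitX -[1]/(FinRing.uval 1%g) (inj_eq val_inj) -order_dvdn.
by rewrite orderXdiv ou dE ?dvdn_mulr // mulKn.
Qed.

Definition legendre (p : nat) (n : int) : int := @quad_char p n%:~R.

Theorem quadratic_reciprocity (p q : nat) :
  prime p -> (2 < p)%N -> prime q -> (2 < q)%N -> p != q ->
  legendre q (legendre p (-1) * p%:Z) = legendre p q%:Z.
Proof.
move=> pp p2 qp q2 pq.
(* By Fermat's little theorem, the field with q^(p-1) elements contains a primitive p-th root of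
   unity. *)
have pqd : (p %| (q ^ p.-1).-1)%N.
  have qF : (q%:R : 'F_p) != 0.
    by rewrite -(dvdn_pcharf (pchar_Fp pp)) dvdn_prime2.
  have := Fp_expf_pred pp qF.
  rewrite (dvdn_pcharf (pchar_Fp pp)) -[(q ^ _).-1%N]subn1 natrB ?expn_gt0 ?prime_gt0 //.
  by rewrite natrX => ->; rewrite subrr.
have p10 : (0 < p.-1)%N by lia.
have [L [z [qL zo]]] := finField_root_order qp p10 pqd.
apply: (gauss_sum_reciprocity pp p2 qp q2 pq qL (z := z)).
  by apply/eqP; rewrite zo.
by rewrite -[z]expr1 zo dvdn1; lia.
Qed.

Section Supplements.
Variable q : nat.
Hypotheses (q_prime : prime q) (q_odd : (2 < q)%N).

Lemma legendreN1 : legendre q (-1) = if (q %% 4 == 1)%N then 1 else -1.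
Proof.
apply: (sign3_inj (pchar_Fp q_prime) q_odd); first exact: quad_char_sign3.
  by case: ifP.
rewrite euler_criterion // rmorphN1 -signr_odd.
have := half_pred_double q_prime q_odd.
by case: ifP => h; case E: (odd _) => //=; lia.
Qed.

(* If [z] is a primitive 8th root of unity, [z + 1/z] is a square root of 2. *)
Lemma legendre2 : legendre q 2 = if (q %% 8 \in [:: 1; 7])%N then 1 else -1.
Proof.
have q8 : (8 %| (q ^ 2).-1)%N.
  have := half_pred_double q_prime q_odd; set h := (_./2) => hE.
  have -> : (q = h.*2.+1)%N by lia.
  have -> : ((h.*2.+1 ^ 2).-1 = 4 * (h * h.+1))%N by rewrite -mulnn; nia.
  rewrite (_ : 8 = 4 * 2)%N // dvdn_pmul2l // dvdn2 oddM /=; by case: (odd h).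
have [L [z [qL zo]]] := finField_root_order q_prime (isT : 0 < 2)%N q8.
have z8 : z ^+ 8 = 1 by apply/eqP; rewrite zo.
have z4 : z ^+ 4 = -1.
  have : (z ^+ 4) ^+ 2 == 1 by rewrite -exprM z8.
  by rewrite sqrf_eq1 zo /= => /eqP.
pose w := z + z ^+ 7.
have w2 : w ^+ 2 = 2%:~R.
  have -> : w ^+ 2 = z ^+ 2 + 2 * z ^+ 8 + z ^+ 8 * z ^+ 4 * z ^+ 2 by rewrite /w; ring.
  by rewrite z8 z4; ring.
have two0 : (2%:~R : L) != 0.
  rewrite (pchar_int_eq0 _ qL); apply/negP => /dvdn_leq; lia.
have w0 : w != 0 by apply: contraNneq two0 => w0; rewrite -w2 w0 expr0n.
have zq n : z ^+ n = z ^+ (n %% 8) by rewrite expr_mod.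
have wq : w ^+ q = (if (q %% 8 \in [:: 1; 7])%N then 1 else -1) * w.
  rewrite -(pFrobenius_autE qL) rmorphD rmorphXn /= pFrobenius_autE -exprM.
  rewrite zq [z ^+ (q * 7)]zq -modnMml.
  have : (q %% 8 \in [:: 1; 3; 5; 7])%N.
    have := half_pred_double q_prime q_odd; rewrite !inE; lia.
  have z5 : z ^+ 5 = - z by rewrite (exprD z 4 1) z4 mulN1r expr1.
  have z7 : z ^+ 7 = - z ^+ 3 by rewrite (exprD z 4 3) z4 mulN1r.
  rewrite !inE => /or4P[] /eqP->; rewrite /w.
  - by rewrite mul1r expr1.
  - by rewrite [(_ %% _)%N]/= [(_ * _ %% _)%N]/= z5 z7 /=; ring.
  - by rewrite [(_ %% _)%N]/= [(_ * _ %% _)%N]/= z5 z7 /=; ring.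
  - by rewrite [(_ %% _)%N]/= mul1r addrC expr1.
apply: (sign3_inj qL q_odd); first exact: quad_char_sign3.
  by case: ifP.
rewrite -euler_criterion_pchar // -w2 -exprM mul2n half_pred_double //.
apply: (mulIf w0); rewrite -exprSr prednK ?prime_gt0 // wq.
by case: ifP => _; rewrite ?rmorphN ?rmorph1.
Qed.

End Supplements.

(** * Primes with prescribed quadratic symbols *)

Definition chi4 (n : nat) : int :=
  if (n %% 4 == 1)%N then 1 else if (n %% 4 == 3)%N then -1 else 0.

Definition chi8 (n : nat) : int :=
  if (n %% 8 \in [:: 1; 7])%N then 1 else if (n %% 8 \in [:: 3; 5])%N then -1 else 0.

Lemma chi4M m n : chi4 (m * n)%N = chi4 m * chi4 n.
Proof.
rewrite /chi4 -modnMm; have := ltn_pmod m (isT : 0 < 4)%N.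
have := ltn_pmod n (isT : 0 < 4)%N.
by case: (m %% 4)%N => [|[|[|[|]]]] //; case: (n %% 4)%N => [|[|[|[|]]]].
Qed.

Lemma chi8M m n : chi8 (m * n)%N = chi8 m * chi8 n.
Proof.
rewrite /chi8 -modnMm; have := ltn_pmod m (isT : 0 < 8)%N.
have := ltn_pmod n (isT : 0 < 8)%N.
by case: (m %% 8)%N => [|[|[|[|[|[|[|[|]]]]]]]] //;
  case: (n %% 8)%N => [|[|[|[|[|[|[|[|]]]]]]]].
Qed.

Lemma legendreM p m n : prime p -> (2 < p)%N ->
  legendre p (m * n) = legendre p m * legendre p n.
Proof. by move=> pp p2; rewrite /legendre rmorphM /= quad_charM. Qed.

Lemma legendre_eqz_mod p m n : prime p -> (p%:Z %| m - n)%Z ->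
  legendre p m = legendre p n.
Proof.
move=> pp mn; congr (quad_char _); apply/eqP.
by rewrite -subr_eq0 -rmorphB /= (pchar_int_eq0 _ (pchar_Fp pp)).
Qed.

Lemma legendre_modn p m n : prime p -> (m = n %[mod p])%N ->
  legendre p m%:Z = legendre p n%:Z.
Proof.
move=> pp mn; apply: legendre_eqz_mod => //.
by rewrite -eqz_mod_dvd !modz_nat mn.
Qed.

Lemma legendre_unit p n : prime p -> ~~ (p%:Z %| n)%Z ->
  legendre p n = 1 \/ legendre p n = -1.
Proof.
move=> pp pn; apply: quad_char_unit.
by rewrite (pchar_int_eq0 _ (pchar_Fp pp)).
Qed.

Lemma legendre_eq1 p n : prime p -> (2 < p)%N -> legendre p n = 1 ->
  exists y : nat, (p%:Z %| y%:Z ^+ 2 - n)%Z.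
Proof.
move=> pp p2 /(quad_char_eq1 pp p2)[y yE]; exists y.
rewrite dvdzE -(pchar_int_eq0 _ (pchar_Fp pp)).
by rewrite rmorphB rmorphXn /= yE -[(y%:Z)%:~R]pmulrn natr_Zp subrr.
Qed.

Section Selection.
Variable ps : seq nat.
Hypothesis ps_prime : all (fun p => prime p && (2 < p)%N) ps.
Hypothesis ps_uniq : uniq ps.

Let k := (8 * \prod_(p <- ps) p)%N.
Let I : finType := option (option 'I_(size ps)).
Let c (i : I) (n : nat) : int :=
  match i with
  | None => chi4 n
  | Some None => chi8 n
  | Some (Some j) => legendre (nth 0%N ps j) n%:Z
  end.

Let nth_prime (j : 'I_(size ps)) : prime (nth 0%N ps j) && (2 < nth 0%N ps j)%N.
Proof. by have /allP := ps_prime; apply; apply: mem_nth. Qed.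

Let ps_mem p : p \in ps -> prime p && (2 < p)%N.
Proof. by have /allP := ps_prime; apply. Qed.

Let prod_coprime (s : seq nat) m : {in s, forall p, coprime m p} ->
  coprime m (\prod_(p <- s) p).
Proof.
elim: s => [|p s IH] sm; first by rewrite big_nil coprimen1.
rewrite big_cons coprimeMr sm ?mem_head // IH // => x xs.
by apply: sm; rewrite inE xs orbT.
Qed.

Let coprime8 p : prime p -> (2 < p)%N -> coprime 8 p.
Proof.
by move=> pp p2; rewrite (@coprimeXl 3 2) // prime_coprime // dvdn_prime2 // neq_ltn p2.
Qed.

Let coprime_crt (p m x : nat) : coprime p m -> coprime x p ->
  exists a, [/\ coprime a (p * m), (a = x %[mod p])%N & (a = 1 %[mod m])%N].
Proof.
move=> pm xp; exists (chinese p m x 1).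
have h1 := chinese_modl pm x 1; have h2 := chinese_modr pm x 1.
split=> //; rewrite coprimeMr -[coprime _ p]coprime_modl h1 coprime_modl xp.
by rewrite -coprime_modl h2 coprime_modl coprime1n.
Qed.

Let k8 : (8 %| k)%N. Proof. exact: dvdn_mulr. Qed.

Let kp p : p \in ps -> (p %| k)%N.
Proof. by move=> pps; rewrite /k (big_rem p) //= mulnCA dvdn_mulr. Qed.

Let k_gt0 : (0 < k)%N.
Proof.
rewrite /k muln_gt0 /= big_seq_cond prodn_cond_gt0 // => p /andP[/ps_mem/andP[pp _] _].
exact: prime_gt0.
Qed.

Let chi4_mod m n : (m = n %[mod 8])%N -> chi4 m = chi4 n.
Proof.
move=> mn; rewrite /chi4 -(@modn_dvdm 8 m 4) // mn modn_dvdm //.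
Qed.

Let chi8_mod m n : (m = n %[mod 8])%N -> chi8 m = chi8 n.
Proof. by rewrite /chi8 => ->. Qed.

Let chi48_odd n : coprime n 8 ->
  (chi4 n = 1 \/ chi4 n = -1) /\ (chi8 n = 1 \/ chi8 n = -1).
Proof.
rewrite -coprime_modl /chi8 /chi4 -(@modn_dvdm 8 n 4) //.
have := ltn_pmod n (isT : 0 < 8)%N.
by case: (n %% 8)%N => [|[|[|[|[|[|[|[|]]]]]]]] //=; auto.
Qed.

Let cM i m n : c i (m * n)%N = c i m * c i n.
Proof.
case: i => [[j|]|] /=; [|exact: chi8M|exact: chi4M].
by have /andP[pp p2] := nth_prime j; rewrite PoszM legendreM.
Qed.

Let modDk n d : (d %| k)%N -> (n + k = n %[mod d])%N.
Proof. by move=> dk; rewrite -modnDmr (eqP dk) addn0. Qed.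

Let c_per i n : c i (n + k)%N = c i n.
Proof.
case: i => [[j|]|] /=; [|exact/chi8_mod/modDk|exact/chi4_mod/modDk].
have /andP[pp p2] := nth_prime j; apply: legendre_modn => //.
by apply/modDk/kp/mem_nth.
Qed.

Let c_val i n : coprime n k -> c i n = 1 \/ c i n = -1.
Proof.
move=> nk; have /chi48_odd[n4 n8] : coprime n 8 by apply: coprime_dvdr nk.
case: i => [[j|]|] //=; have /andP[pp p2] := nth_prime j.
apply: legendre_unit => //; rewrite dvdzE -prime_coprime // coprime_sym.
by apply: coprime_dvdr nk; apply/kp/mem_nth.
Qed.

(** Chinese remaindering: a nonresidue modulo one prime and 1 modulo the rest of k. Modulo 8, the
    class 5 flips only [chi8] and 7 only [chi4]. *)
Let c_dual i : exists a, [/\ coprime a k, c i a = -1 & forall j, j != i -> c j a = 1].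
Proof.
have P8 : coprime 8 (\prod_(p <- ps) p).
  by apply: prod_coprime => p /ps_mem/andP[]; apply: coprime8.
have leg1 a m p : (a = 1 %[mod m])%N -> p \in ps -> (p %| m)%N -> legendre p a%:Z = 1.
  move=> a1 /ps_mem/andP[pp p2] pm; rewrite (@legendre_modn p a 1) //.
    exact: quad_char1.
  by rewrite -(modn_dvdm a pm) a1 modn_dvdm.
have dvdP p : p \in ps -> (p %| \prod_(p <- ps) p)%N.
  by move=> pps; rewrite (big_rem p) //= dvdn_mulr.
case: i => [[i|]|].
- set p := nth 0%N ps i; have pps : p \in ps by apply: mem_nth.
  have /andP[pp p2] := ps_mem pps.
  pose m := (8 * \prod_(x <- rem p ps) x)%N.
  have kE : k = (p * m)%N by rewrite /k (big_rem p) //= mulnCA.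
  have pm : coprime p m.
    rewrite coprimeMr coprime_sym coprime8 //=; apply: prod_coprime => x xr.
    have xps := mem_rem xr; have /andP[xp x2] := ps_mem xps.
    rewrite prime_coprime // dvdn_prime2 //; move: xr.
    by rewrite mem_rem_uniq // !inE eq_sym => /andP[].
  have [y yN] := quad_char_nonresidue pp p2.
  have yp : coprime y p.
    rewrite coprime_sym prime_coprime // (dvdn_pcharf (pchar_Fp pp)) natr_Zp.
    by apply/eqP => y0; move: yN; rewrite y0 quad_char0.
  have [a [ak ay a1]] := coprime_crt pm yp; exists a; split; first by rewrite kE.
    rewrite /= -/p (legendre_modn pp ay) /legendre -[(y%:Z)%:~R]pmulrn natr_Zp.
    exact: yN.
  have a8 : (a = 1 %[mod 8])%N.
    have d8 : (8 %| m)%N by rewrite dvdn_mulr.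
    by rewrite -(modn_dvdm a d8) a1 modn_dvdm.
  case=> [[j|]|] ji /=; [|by rewrite (chi8_mod a8)|by rewrite (chi4_mod a8)].
  apply: leg1 a1 _ _; first exact: mem_nth.
  rewrite dvdn_mull // (big_rem (nth 0%N ps j)) /= ?dvdn_mulr //.
  rewrite mem_rem_uniq // !inE mem_nth // andbT nth_uniq //.
- have [a [ak ay a1]] := coprime_crt P8 (isT : coprime 5 8).
  exists a; split=> //=; first by rewrite (chi8_mod ay).
  case=> [[j|]|] //= _; last by rewrite (chi4_mod ay).
  by apply: leg1 a1 _ _; [|apply: dvdP]; apply: mem_nth.
- have [a [ak ay a1]] := coprime_crt P8 (isT : coprime 7 8).
  exists a; split=> //=; first by rewrite (chi4_mod ay).
  case=> [[j|]|] //= _; last by rewrite (chi8_mod ay).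
  by apply: leg1 a1 _ _; [|apply: dvdP]; apply: mem_nth.
Qed.

(* The residues 5 and 7 modulo 8 make the prescribed pattern nontrivial, so that a
   prime power with this pattern has odd exponent and its prime has it too. *)
Lemma prime_with_legendre (r : nat) (e : nat -> int) :
  r = 5%N \/ r = 7%N -> {in ps, forall p, e p = 1 \/ e p = -1} ->
  exists q, [/\ prime q, (q %% 8)%N = r &
    {in ps, forall p, q != p /\ legendre p q%:Z = e p}].
Proof.
move=> r57 e_val.
pose ce (i : I) : int := match i with
  | None => chi4 r | Some None => chi8 r | Some (Some j) => e (nth 0%N ps j) end.
have ce_val i : ce i = 1 \/ ce i = -1.
  case: i => [[j|]|] /=; first exact/e_val/mem_nth.
    by case: r57 => rE; rewrite rE; auto.
  by case: r57 => rE; rewrite rE; auto.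
pose R : realType := Rdefinitions.R.
have cast_inj (x y : int) : x%:~R = y%:~R :> R -> x = y by apply: intr_inj.
have [|||||q [f [qp qk qe]]] := @character_pattern R I k
    (fun i n => (c i n)%:~R) (fun i => (ce i)%:~R) k_gt0.
- by move=> i m n; rewrite cM rmorphM.
- by move=> i n; rewrite c_per.
- by move=> i n nk; case: (c_val i nk) => ->; auto.
- move=> i; have [a [ak ai aj]] := c_dual i; exists a; split=> //.
    by rewrite ai.
  by move=> j ji; rewrite aj.
- by move=> i; case: (ce_val i) => ->; auto.
have cX i n : c i (q ^ n)%N = c i q ^+ n.
  elim: n => [|n IH]; last by rewrite expnS cM IH exprS.
  by rewrite expn0 expr0; case: i => [[j|]|] //=; apply: quad_char1.
have {}qe i : c i q ^+ f.+1 = ce i by rewrite -cX; apply/cast_inj/qe.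
have odd_f : odd f.+1.
  have [i iN] : exists i, ce i = -1.
    by case: r57 => rE; [exists (Some None) | exists None]; rewrite /ce rE.
  case: (boolP (odd f.+1)) => // f_even; move: (qe i).
  rewrite iN -[f.+1]odd_double_half (negbTE f_even) add0n -mul2n exprM.
  by case: (c_val i qk) => ->; rewrite ?sqrrN !expr1n.
have {}qe i : c i q = ce i.
  rewrite -(qe i); case: (c_val i qk) => ->; first by rewrite expr1n.
  by rewrite -signr_odd odd_f.
have q8 : coprime q 8 by apply: coprime_dvdr qk.
exists q; split=> //.
  have := qe None; have := qe (Some None); rewrite /= /chi8 /chi4.
  move: q8; rewrite -coprime_modl -(@modn_dvdm 8 q 4) //.
  have := ltn_pmod q (isT : 0 < 8)%N.
  by case: r57 => ->; case: (q %% 8)%N => [|[|[|[|[|[|[|[|]]]]]]]].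
move=> p pps; split.
  apply: contraTneq qk => qE; rewrite /coprime qE.
  by rewrite (gcdn_idPl (kp pps)) -qE neq_ltn prime_gt1 ?orbT.
have pj : (index p ps < size ps)%N by rewrite index_mem.
by have := qe (Some (Some (Ordinal pj))); rewrite /= nth_index.
Qed.

End Selection.

(** * Legendre's theorem on ternary forms *)

Lemma nat_sqrt_exists n : exists r, (r ^ 2 <= n < r.+1 ^ 2)%N.
Proof.
elim: n => [|n [r /andP[h1 h2]]]; first by exists 0%N.
have [h|h] := leqP (r.+1 ^ 2) n.+1; last by exists r; rewrite h andbT; lia.
by exists r.+1; rewrite h /= -!mulnn in h2 *; nia.
Qed.

(** The b-adic valuation of b c is 1. This makes two of the box inequalities strict in
    [legendre_ternary], which is why b is prime there. *)
Lemma prime_mul_not_sqr b c r : prime b -> coprime b c -> (r ^ 2 != b * c)%N.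
Proof.
move=> bp bc; apply/eqP => rE.
have : (b %| r ^ 2)%N by rewrite rE dvdn_mulr.
rewrite Euclid_dvdX // andbT => /dvdnP[d dE].
have : (b %| c)%N.
  have b0 := prime_gt0 bp; apply/dvdnP; exists (d ^ 2)%N.
  by apply/eqP; rewrite -(eqn_pmul2l b0) -rE dE; apply/eqP; ring.
by move=> /gcdn_idPl; rewrite (eqP bc) => b1; move: bp; rewrite -b1.
Qed.

Lemma eqn_mod_dvdz (d m n : nat) : (m = n %[mod d])%N -> (d%:Z %| m%:Z - n%:Z)%Z.
Proof. by move=> mn; rewrite -eqz_mod_dvd !modz_nat mn. Qed.

Lemma ord_diff_sqr_le (D M : nat) (u v : 'I_D.+1) : (D ^ 2 <= M)%N ->
  (u%:Z - v%:Z) ^+ 2 <= M%:Z.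
Proof.
have := ltn_ord u; have := ltn_ord v; rewrite !ltnS.
move: (nat_of_ord u) (nat_of_ord v) => i j hj hi hD.
apply: (@le_trans _ _ ((D ^ 2)%N%:Z)); last by rewrite lez_nat.
have h1 : 0 <= D%:Z - (i%:Z - j%:Z) by lia.
have h2 : 0 <= D%:Z + (i%:Z - j%:Z) by lia.
have := mulr_ge0 h1 h2; rewrite -subr_sqr subr_ge0.
by rewrite -mulnn PoszM -expr2.
Qed.

(** Pigeonhole: a box with sides floor(sqrt(bc)), floor(sqrt(ac)), floor(sqrt(ab)) has more than abc
    integral points, and there are abc triples of residues. *)
Lemma ternary_box (a b c l m n : nat) :
  (0 < a)%N -> (0 < b)%N -> (0 < c)%N ->
  exists x y z : int, [/\ (x, y, z) != (0, 0, 0),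
    [/\ x ^+ 2 <= (b * c)%:Z, y ^+ 2 <= (a * c)%:Z & z ^+ 2 <= (a * b)%:Z] &
    [/\ (a%:Z %| y + l%:Z * z)%Z, (b%:Z %| x + m%:Z * z)%Z
       & (c%:Z %| x + n%:Z * y)%Z]].
Proof.
move=> a0 b0 c0.
have [A /andP[A1 A2]] := nat_sqrt_exists (b * c).
have [B /andP[B1 B2]] := nat_sqrt_exists (a * c).
have [C /andP[C1 C2]] := nat_sqrt_exists (a * b).
pose f (t : 'I_A.+1 * 'I_B.+1 * 'I_C.+1) : 'I_a * 'I_b * 'I_c :=
  (Ordinal (ltn_pmod (t.1.2 + l * t.2) a0),
   Ordinal (ltn_pmod (t.1.1 + m * t.2) b0),
   Ordinal (ltn_pmod (t.1.1 + n * t.1.2) c0)).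
have /injectivePn[[[x y] z] [[[x' y'] z'] ne fE]] : ~~ injectiveb f.
  apply/negP => /injectiveP/leq_card; rewrite !card_prod !card_ord leqNgt.
  move/negP; apply; rewrite -ltn_sqr.
  have -> : ((a * b * c) ^ 2 = (b * c) * (a * c) * (a * b))%N by ring.
  rewrite !expnMn; apply: ltn_mul => //; exact: ltn_mul.
case: fE => h1 h2 h3.
exists (x%:Z - x'%:Z), (y%:Z - y'%:Z), (z%:Z - z'%:Z); split.
- apply: contra ne => /eqP[xE yE zE].
  apply/eqP; congr (_, _, _); apply/val_inj/eqP;
    by rewrite -eqz_nat -subr_eq0 ?xE ?yE ?zE.
- by split; apply: ord_diff_sqr_le.
- split.
  + by have := eqn_mod_dvdz h1; rewrite !PoszD !PoszM; congr (_ %| _)%Z; ring.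
  + by have := eqn_mod_dvdz h2; rewrite !PoszD !PoszM; congr (_ %| _)%Z; ring.
  + by have := eqn_mod_dvdz h3; rewrite !PoszD !PoszM; congr (_ %| _)%Z; ring.
Qed.

(* A lattice of index [abc] on which [a x^2 + b y^2 - c z^2] is divisible by [abc]
   has a nonzero point where this form lies strictly between [-abc] and [2abc];
   the value [abc] is removed by composing with [z^2 + ab]. *)
Theorem legendre_ternary (a b c l m n : nat) :
  (0 < a)%N -> prime b -> (0 < c)%N ->
  coprime a b -> coprime a c -> coprime b c ->
  (a%:Z %| b%:Z * l%:Z ^+ 2 - c%:Z)%Z ->
  (b%:Z %| a%:Z * m%:Z ^+ 2 - c%:Z)%Z ->
  (c%:Z %| a%:Z * n%:Z ^+ 2 + b%:Z)%Z ->
  exists x y z : int, z != 0 /\ a%:Z * x ^+ 2 + b%:Z * y ^+ 2 = c%:Z * z ^+ 2.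
Proof.
move=> a0 bp c0 ab ac bc hl hm hn; have b0 := prime_gt0 bp.
have [x [y [z [ne [hx hy hz] [h1 h2 h3]]]]] := ternary_box l m n a0 b0 c0.
set F := a%:Z * x ^+ 2 + b%:Z * y ^+ 2 - c%:Z * z ^+ 2.
(* Modulo each coefficient the hypotheses split the form into two linear factors, one of which
   vanishes by the choice of the box point. *)
have d1 : (a%:Z %| F)%Z.
  have -> : F = a%:Z * x ^+ 2 + b%:Z * (y - l%:Z * z) * (y + l%:Z * z)
     + (b%:Z * l%:Z ^+ 2 - c%:Z) * z ^+ 2 by rewrite /F; ring.
  by rewrite !rpredD //; [rewrite dvdz_mulr | rewrite dvdz_mull | rewrite dvdz_mulr].
have d2 : (b%:Z %| F)%Z.
  have -> : F = b%:Z * y ^+ 2 + a%:Z * (x - m%:Z * z) * (x + m%:Z * z)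
     + (a%:Z * m%:Z ^+ 2 - c%:Z) * z ^+ 2 by rewrite /F; ring.
  by rewrite !rpredD //; [rewrite dvdz_mulr | rewrite dvdz_mull | rewrite dvdz_mulr].
have d3 : (c%:Z %| F)%Z.
  have -> : F = - (c%:Z * z ^+ 2) + a%:Z * (x - n%:Z * y) * (x + n%:Z * y)
     + (a%:Z * n%:Z ^+ 2 + b%:Z) * y ^+ 2 by rewrite /F; ring.
  by rewrite !rpredD //; [rewrite rpredN dvdz_mulr | rewrite dvdz_mull | rewrite dvdz_mulr].
have /dvdzP[w wE] : ((a * b * c)%N%:Z %| F)%Z.
  rewrite !PoszM !Gauss_dvdz ?d1 ?d2 ?d3 //.
  by rewrite /coprimez -PoszM /gcdz !absz_nat eqz_nat -/(coprime _ _) coprimeMl ac bc.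
have xs : x ^+ 2 < (b * c)%:Z.
  rewrite lt_neqAle hx andbT; have := prime_mul_not_sqr `|x| bp bc.
  by apply: contra => /eqP xE; rewrite -eqz_nat -abszX gez0_abs ?sqr_ge0 // xE.
have zs : z ^+ 2 < (a * b)%:Z.
  rewrite lt_neqAle hz andbT; rewrite coprime_sym in ab.
  have := prime_mul_not_sqr `|z| bp ab.
  by apply: contra => /eqP zE; rewrite -eqz_nat -abszX gez0_abs ?sqr_ge0 // zE mulnC.
have a0' : 0 < a%:Z by [].
have b0' : 0 < b%:Z by [].
have c0' : 0 < c%:Z by [].
have W0 : 0 < (a * b * c)%N%:Z by rewrite !PoszM !mulr_gt0.
have Fu : F < 2 * (a * b * c)%N%:Z.
  have e1 := mulr_ge0 (ltW c0') (sqr_ge0 z).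
  have e2 := ler_wpM2l (ltW b0') hy.
  have : a%:Z * x ^+ 2 < a%:Z * (b * c)%N%:Z by rewrite ltr_pM2l.
  by move: e1 e2; rewrite /F !PoszM; lra.
have Fl : - (a * b * c)%N%:Z < F.
  have e1 := mulr_ge0 (ltW a0') (sqr_ge0 x).
  have e2 := mulr_ge0 (ltW b0') (sqr_ge0 y).
  have : c%:Z * z ^+ 2 < c%:Z * (a * b)%N%:Z by rewrite ltr_pM2l.
  by move: e1 e2; rewrite /F !PoszM; lra.
have w01 : w = 0 \/ w = 1.
  have w2 : w < 2 by rewrite -(ltr_pM2r W0) -wE.
  have wm : -1 < w by rewrite -(ltr_pM2r W0) -wE mulN1r.
  by move: w2 wm; clear; lia.
case: w01 => wv.
  exists x, y, z; move: wE; rewrite wv mul0r => /eqP; rewrite subr_eq0 => /eqP E.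
  split=> //; apply: contra ne => /eqP z0; move: E; rewrite z0 expr0n /= mulr0.
  have e1 := mulr_ge0 (ltW a0') (sqr_ge0 x).
  have e2 := mulr_ge0 (ltW b0') (sqr_ge0 y).
  move=> E; have /eqP : a%:Z * x ^+ 2 = 0 by lra.
  have /eqP : b%:Z * y ^+ 2 = 0 by lra.
  by rewrite !mulf_eq0 !orbb (gt_eqF a0') (gt_eqF b0') /= => /eqP-> /eqP->.
exists (x * z + b%:Z * y), (y * z - a%:Z * x), (z ^+ 2 + (a * b)%N%:Z); split.
  by rewrite gt_eqF // ltr_wpDl ?sqr_ge0 // PoszM mulr_gt0.
have E : a%:Z * x ^+ 2 + b%:Z * y ^+ 2 = c%:Z * (z ^+ 2 + (a * b)%N%:Z).
  by move: wE; rewrite /F wv mul1r !PoszM; lra.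
transitivity ((a%:Z * x ^+ 2 + b%:Z * y ^+ 2) * (z ^+ 2 + (a * b)%N%:Z)).
  by rewrite PoszM; ring.
by rewrite E; ring.
Qed.

(** * Rational representations by x^2 + y^2 + 3z^2 *)

Lemma dvdz_sqr_mod (a c : int) (p x y : nat) : (x = y %[mod p])%N ->
  (p%:Z %| a * x%:Z ^+ 2 + c)%Z -> (p%:Z %| a * y%:Z ^+ 2 + c)%Z.
Proof.
move=> /eqn_mod_dvdz xy h.
have -> : a * y%:Z ^+ 2 + c =
   a * x%:Z ^+ 2 + c - a * (x%:Z + y%:Z) * (x%:Z - y%:Z) by ring.
by rewrite rpredB // dvdz_mull.
Qed.

Lemma coprime_prod_primes (s : seq nat) p : prime p -> all prime s -> p \notin s ->
  coprime p (\prod_(x <- s) x).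
Proof.
move=> pp; elim: s => [|x s IH]; first by rewrite big_nil coprimen1.
move=> /= /andP[xp sp]; rewrite inE negb_or => /andP[px ps].
by rewrite big_cons coprimeMr IH // prime_coprime // dvdn_prime2 // px.
Qed.

Lemma dvdz_sqr_prod (s : seq nat) (a c : int) : uniq s -> all prime s ->
  {in s, forall p, exists x : nat, (p%:Z %| a * x%:Z ^+ 2 + c)%Z} ->
  exists x : nat, ((\prod_(p <- s) p)%N%:Z %| a * x%:Z ^+ 2 + c)%Z.
Proof.
elim: s => [|p s IH] /=; first by exists 0%N; rewrite big_nil dvd1z.
case/andP=> ps us /andP[pp sp] H.
have [x xd] := H p (mem_head _ _).
have [|y yd] := IH us sp; first by move=> r rs; apply: H; rewrite inE rs orbT.
have cop := coprime_prod_primes pp sp ps.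
exists (chinese p (\prod_(r <- s) r) x y).
rewrite big_cons PoszM Gauss_dvdz; last first.
  by rewrite /coprimez /gcdz !absz_nat eqz_nat.
apply/andP; split.
  by apply: dvdz_sqr_mod xd; rewrite chinese_modl.
by apply: dvdz_sqr_mod yd; rewrite chinese_modr.
Qed.

Lemma legendre_prod q (s : seq nat) : prime q -> (2 < q)%N ->
  legendre q (\prod_(p <- s) p)%N%:Z = \prod_(p <- s) legendre q p%:Z.
Proof.
move=> qp q2; elim: s => [|p s IH]; first by rewrite !big_nil; apply: quad_char1.
by rewrite !big_cons PoszM legendreM // IH.
Qed.

Lemma legendre_3 n : legendre 3 n%:Z =
  if (n %% 3 == 1)%N then 1 else if (n %% 3 == 2)%N then -1 else 0.
Proof.
rewrite -(@legendre_modn 3 (n %% 3) n) ?modn_mod //.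
have := ltn_pmod n (isT : 0 < 3)%N; by case: (n %% 3)%N => [|[|[|]]].
Qed.

Lemma legendreN3 q : prime q -> (3 < q)%N -> legendre q (-3) = legendre 3 q%:Z.
Proof.
move=> qp q3; rewrite -(@quadratic_reciprocity 3 q) ?legendreN1 //; first lia.
by rewrite neq_ltn q3.
Qed.

(** Legendre's theorem for 1, 3, q: the condition modulo q is (-3/q) = (q/3) = 1, the one modulo 3
    is q = 1. *)
Lemma prime_norm3 q : prime q -> (3 < q)%N -> (q %% 3 = 1)%N ->
  exists y v u : int, u != 0 /\ y ^+ 2 + 3 * v ^+ 2 = q%:Z * u ^+ 2.
Proof.
move=> qp q3 q1.
have [n hn] : exists n : nat, (q%:Z %| n%:Z ^+ 2 - (-3))%Z.
  by apply: legendre_eq1; [| lia | rewrite legendreN3 // legendre_3 q1].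
have c3q : coprime 3 q by rewrite prime_coprime // dvdn_prime2 // neq_ltn q3.
have [|||||||||y [v [u [u0 E]]]] := @legendre_ternary 1 3 q 0 1 n.
- by [].
- by [].
- exact: prime_gt0.
- by [].
- exact: coprime1n.
- exact: c3q.
- by rewrite dvd1z.
- rewrite -opprB rpredN !expr1n mulr1.
  have -> : q%:Z - 1 = (q %/ 3)%:Z * 3 by have := divn_eq q 3; lia.
  by rewrite dvdz_mull.
- by rewrite mul1r; move: hn; rewrite opprK.
by exists y, v, u; split=> //; rewrite -E mul1r.
Qed.

Lemma inverse_3_mod p : (p %% 3 = 1)%N \/ (p %% 3 = 2)%N ->
  exists k : nat, (p%:Z %| 3 * k%:Z - 1)%Z.
Proof.
case=> pm; [exists ((2 * p + 1) %/ 3)%N | exists ((p + 1) %/ 3)%N].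
  have -> : 3 * ((2 * p + 1) %/ 3)%N%:Z - 1 = 2 * p%:Z by lia.
  by rewrite dvdz_mull.
by have -> : 3 * ((p + 1) %/ 3)%N%:Z - 1 = p%:Z by lia.
Qed.

Section RationalRepresentation.
Variable s : seq nat.
Hypotheses (s_uniq : uniq s) (s_prime : all prime s).

Let odd_part := [seq p <- s | (2 < p)%N].

Let odd_partP : all (fun p => prime p && (2 < p)%N) odd_part.
Proof.
apply/allP => p; rewrite mem_filter => /andP[p2 ps].
by rewrite p2 (allP s_prime).
Qed.

Lemma prod_pos : (0 < \prod_(p <- s) p)%N.
Proof.
rewrite big_seq_cond prodn_cond_gt0 // => p /andP[ps _].
exact/prime_gt0/(allP s_prime).
Qed.

Let split_prime p : p \in s -> p = 2%N \/ (p \in odd_part).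
Proof.
move=> ps; have p1 := prime_gt1 (allP s_prime _ ps).
rewrite mem_filter ps andbT; lia.
Qed.

(** Adding 3 to the list with value 1 forces q = 1 mod 3. *)
Let select (r : nat) (e : nat -> int) :
  3%N \notin s -> r = 5%N \/ r = 7%N ->
  {in odd_part, forall p, e p = 1 \/ e p = -1} ->
  exists q, [/\ prime q, (3 < q)%N, (q %% 8)%N = r, (q %% 3)%N = 1%N &
    coprime q (\prod_(p <- s) p)
    /\ {in odd_part, forall p, q != p /\ legendre p q%:Z = e p}].
Proof.
move=> s3 r57 he.
have nin : 3%N \notin odd_part by rewrite mem_filter negb_and s3 orbT.
have [||||q [qp q8 qe]] := @prime_with_legendre (3 :: odd_part) _ _ r
  (fun p => if p == 3%N then 1 else e p).
- by rewrite /= odd_partP.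
- by rewrite /= nin filter_uniq.
- exact: r57.
- move=> p; rewrite inE => /orP[/eqP->|pp]; first by left.
  by case: eqP => _; [left | apply: he].
have [q3 L3] := qe 3%N (mem_head _ _).
have q2 : q <> 2%N by move=> E; move: q8; rewrite E; case: r57 => ->.
have q3' : (3 < q)%N by have := prime_gt1 qp; move/eqP: q3; lia.
have he' p : p \in odd_part -> q != p /\ legendre p q%:Z = e p.
  move=> pp; have pp' : p \in 3%N :: odd_part by rewrite inE pp orbT.
  have [qp' ->] := qe p pp'; split=> //.
  by case: eqP => // E; move: pp; rewrite E (negbTE nin).
exists q; split=> //.
  by move: L3; rewrite legendre_3 /=; case: eqP => // _; case: eqP.
split=> //; apply: coprime_prod_primes => //.
apply/negP => /split_prime[] // /he'[]; by rewrite eqxx.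
Qed.

Lemma rational_rep_coprime3 : 3%N \notin s -> exists x y z t : int,
  t != 0 /\ x ^+ 2 + y ^+ 2 + 3 * z ^+ 2 = (\prod_(p <- s) p)%N%:Z * t ^+ 2.
Proof.
move=> s3; set N := (\prod_(p <- s) p)%N.
have [p|q [qp q3 q8 q1 [qN qe]]] := @select 7 (fun p => legendre p (-1)) s3
  (or_intror erefl).
  by case/(allP odd_partP)/andP => pp p2; rewrite legendreN1 //; case: ifP; auto.
have q2 : (2 < q)%N by lia.
have qm1 : legendre q (-1) = -1 by rewrite legendreN1 //; case: ifP => //; lia.
have Lp p : p \in s -> legendre q p%:Z = 1.
  case/split_prime=> [->|po]; first by rewrite legendre2 // q8.
  have /andP[pp p2] := allP odd_partP _ po; have [qp' E] := qe p po.
  have := quadratic_reciprocity pp p2 qp q2; rewrite eq_sym qp' E => /(_ isT).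
  rewrite legendreM // legendreN1 //; case: ifP => _.
    by rewrite [legendre q 1]quad_char1 mul1r.
  by rewrite qm1 mulN1r => /oppr_inj.
have [m hm] : exists m : nat, (q%:Z %| m%:Z ^+ 2 - N%:Z)%Z.
  by apply: legendre_eq1 => //; rewrite legendre_prod // big_seq big1.
have [n hn] : exists n : nat, (N%:Z %| 1 * n%:Z ^+ 2 + q%:Z)%Z.
  apply: dvdz_sqr_prod => // p /split_prime[->|po].
    by exists 1%N; rewrite mul1r expr1n; lia.
  have /andP[pp p2] := allP odd_partP _ po; have [_ E] := qe p po.
  have [|n hn] := @legendre_eq1 p (- q%:Z) pp p2.
    by rewrite -mulN1r legendreM // E legendreN1 //; case: ifP.
  by exists n; rewrite mul1r; rewrite opprK in hn.
have [|||||||||x [w [t [t0 E]]]] := @legendre_ternary 1 q N 0 m n.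
- by [].
- by [].
- exact: prod_pos.
- exact: coprime1n.
- exact: coprime1n.
- exact: qN.
- by rewrite dvd1z.
- by rewrite mul1r.
- exact: hn.
have [y [v [u [u0 E']]]] := prime_norm3 qp q3 q1.
exists (x * u), (y * w), (v * w), (t * u); split; first by rewrite mulf_neq0.
rewrite !exprMn [RHS]mulrA -E mul1r [RHS]mulrDl.
have -> : q%:Z * w ^+ 2 * u ^+ 2 = (q%:Z * u ^+ 2) * w ^+ 2 by ring.
by rewrite -E'; ring.
Qed.

Lemma rational_rep_triple : 3%N \notin s -> (\prod_(p <- s) p %% 3 = 1)%N ->
  exists x y z t : int,
  t != 0 /\ x ^+ 2 + y ^+ 2 + 3 * z ^+ 2 = (3 * \prod_(p <- s) p)%N%:Z * t ^+ 2.
Proof.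
move=> s3; set N := (\prod_(p <- s) p)%N => N1.
have mod3 p : p \in s -> (p %% 3 = 1)%N \/ (p %% 3 = 2)%N.
  move=> ps; have : ~~ (3 %| p)%N.
    have pp := allP s_prime _ ps.
    have p3 : p != 3%N by apply: contraNneq s3 => <-.
    by rewrite dvdn_prime2 // eq_sym.
  by rewrite /dvdn; lia.
have [p|q [qp q3 q8 q1 [qN qe]]] := @select 5 (fun p => legendre 3 p%:Z) s3
  (or_introl erefl).
  rewrite mem_filter => /andP[_ ps]; rewrite legendre_3.
  by case: (mod3 _ ps) => ->; auto.
have q2 : (2 < q)%N by lia.
have qm1 : legendre q (-1) = 1 by rewrite legendreN1 //; case: ifP => //; lia.
have Lp p : p \in s -> legendre q p%:Z = legendre 3 p%:Z.
  case/split_prime=> [->|po]; first by rewrite legendre2 // q8 legendre_3.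
  have /andP[pp p2] := allP odd_partP _ po; have [qp' E] := qe p po.
  have := quadratic_reciprocity pp p2 qp q2; rewrite eq_sym qp' E => /(_ isT) <-.
  rewrite legendreM // legendreN1 //; case: ifP => _.
    by rewrite [legendre q 1]quad_char1 mul1r.
  by rewrite qm1 mul1r.
have L3 : legendre q 3 = 1.
  have := legendreN3 qp q3; rewrite legendre_3 q1 -[- 3]/(-1 * 3 : int).
  by rewrite legendreM // qm1 mul1r.
have LN : legendre q N%:Z = 1.
  rewrite legendre_prod // (eq_big_seq _ Lp) -legendre_prod //.
  by rewrite legendre_3 N1.
have [m hm] : exists m : nat, (q%:Z %| 3%:Z * m%:Z ^+ 2 - N%:Z)%Z.
  have [|y yd] := @legendre_eq1 q (3 * N%:Z) qp q2; first by rewrite legendreM // L3 LN.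
  have [k kd] := @inverse_3_mod q (or_introl q1).
  exists (k * y)%N; rewrite PoszM.
  have -> : 3%:Z * (k%:Z * y%:Z) ^+ 2 - N%:Z =
    3 * k%:Z ^+ 2 * (y%:Z ^+ 2 - 3 * N%:Z) + (3 * k%:Z + 1) * N%:Z * (3 * k%:Z - 1) by ring.
  by rewrite rpredD // dvdz_mull.
have [n hn] : exists n : nat, (N%:Z %| 3%:Z * n%:Z ^+ 2 + q%:Z)%Z.
  apply: dvdz_sqr_prod => // p ps; case: (split_prime ps) => [->|po].
    by exists 1%N; rewrite expr1n; lia.
  have /andP[pp p2] := allP odd_partP _ po; have [qp' E] := qe p po.
  have p3 : (3 < p)%N.
    by move: (mod3 _ ps) p2; clear; lia.
  have [|y yd] := @legendre_eq1 p (-3 * q%:Z) pp p2.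
    rewrite legendreM // legendreN3 // E legendre_3.
    by case: (mod3 _ ps) => ->.
  have [k kd] := inverse_3_mod (mod3 _ ps).
  exists (k * y)%N; rewrite PoszM.
  have -> : 3%:Z * (k%:Z * y%:Z) ^+ 2 + q%:Z =
    3 * k%:Z ^+ 2 * (y%:Z ^+ 2 - (- 3 * q%:Z)) - (3 * k%:Z + 1) * q%:Z * (3 * k%:Z - 1) by ring.
  by rewrite rpredB // dvdz_mull.
have c3q : coprime 3 q by rewrite prime_coprime // dvdn_prime2 // neq_ltn q3.
have [|||||||||x [w [t [t0 E]]]] := @legendre_ternary 3 q N 1 m n.
- by [].
- by [].
- exact: prod_pos.
- exact: c3q.
- exact: coprime_prod_primes.
- exact: qN.
- rewrite expr1n mulr1.
  have -> : q%:Z - N%:Z = 3 * ((q %/ 3)%N%:Z - (N %/ 3)%N%:Z).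
    by have := divn_eq q 3; have := divn_eq N 3; rewrite -/N in N1; lia.
  by rewrite dvdz_mulr.
- exact: hm.
- exact: hn.
have [y [v [u [u0 E']]]] := prime_norm3 qp q3 q1.
(* Multiply 3x^2 + q w^2 = N t^2 by 3 u^2 and substitute q u^2 = y^2 + 3 v^2; the factor 3 exchanges
   the roles of y and v. *)
exists (3 * x * u), (3 * v * w), (y * w), (t * u); split; first by rewrite mulf_neq0.
rewrite PoszM !exprMn [RHS]mulrA -[3%:Z * N%:Z * _]mulrA -E.
have -> : 3%:Z * (3%:Z * x ^+ 2 + q%:Z * w ^+ 2) * u ^+ 2 =
  9 * x ^+ 2 * u ^+ 2 + 3 * (q%:Z * u ^+ 2) * w ^+ 2 by ring.
by rewrite -E'; ring.
Qed.

End RationalRepresentation.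

(** * Integral representations *)

Definition excluded (N : nat) : Prop := exists j m, N = (3 ^ (2 * j + 1) * (3 * m + 2))%N.

Lemma excluded_form_int e m :
  (3 ^ e * (3 * m + 2))%N%:Z = 3 ^+ e * (3 * m%:Z + 2).
Proof. by rewrite PoszM PoszD PoszM -[(3 ^ e)%N%:Z]natz natrX. Qed.

Lemma squarefree_decomposition N : (0 < N)%N -> exists (m : nat) (s : seq nat),
  [/\ (0 < m)%N, uniq s, all prime s & N = (m ^ 2 * \prod_(p <- s) p)%N].
Proof.
elim/ltn_ind: N => N IH N0.
have [->|N1] : N = 1%N \/ (1 < N)%N by lia.
  by exists 1%N, [::]; rewrite big_nil.
have pp := pdiv_prime N1; set p := pdiv N in pp.
have [M NE] : exists M, N = (p * M)%N.
  by have /dvdnP[M ->] := pdiv_dvd N; exists M; rewrite mulnC.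
have M0 : (0 < M)%N by move: N0; rewrite NE muln_gt0 => /andP[].
have [|m [s [m0 us ps ME]]] := IH M _ M0; first by rewrite NE ltn_Pmull ?prime_gt1.
have [pin|pnin] := boolP (p \in s); last first.
  exists m, (p :: s); rewrite /= pnin us pp ps big_cons; split=> //.
  by rewrite NE ME mulnCA.
exists (m * p)%N, (rem p s); split.
- by rewrite muln_gt0 m0 prime_gt0.
- exact: rem_uniq.
- by apply/allP => x /mem_rem; apply/allP.
- by rewrite NE ME (big_rem p) //= expnMn; ring.
Qed.

(** A square contributes an even power of 3, and a square prime to 3 is 1 modulo 3. *)
Lemma excluded_mul_sqr m n : (0 < m)%N -> (n %% 3 = 2)%N -> excluded (m ^ 2 * (3 * n))%N.
Proof.
move=> m0 n2; have [m' m'3 mE] := pfactor_coprime (isT : prime 3) m0.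
rewrite prime_coprime // in m'3; set j := logn 3 m in mE.
have : ((m' ^ 2 * n) %% 3 = 2)%N.
  rewrite -modnMm n2 -modnXm.
  by move: m'3; rewrite /dvdn; have := ltn_pmod m' (isT : 0 < 3)%N; case: (m' %% 3)%N => [|[|[|]]].
move=> h; exists j, ((m' ^ 2 * n) %/ 3)%N.
have -> : (3 * ((m' ^ 2 * n) %/ 3) + 2 = m' ^ 2 * n)%N.
  by rewrite [RHS](divn_eq _ 3) h mulnC.
rewrite {1}mE expnMn -expnM [(j * 2)%N]mulnC expnD expn1.
by move: (3 ^ (2 * j))%N => u; ring.
Qed.

Lemma rational_rep N : (0 < N)%N -> ~ excluded N -> exists x y z t : int,
  t != 0 /\ x ^+ 2 + y ^+ 2 + 3 * z ^+ 2 = N%:Z * t ^+ 2.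
Proof.
move=> N0 Nex; have [m [s [m0 us ps NE]]] := squarefree_decomposition N0.
suff [x [y [z [t [t0 E]]]]] : exists x y z t : int, t != 0 /\
    x ^+ 2 + y ^+ 2 + 3 * z ^+ 2 = (\prod_(p <- s) p)%N%:Z * t ^+ 2.
  exists (m%:Z * x), (m%:Z * y), (m%:Z * z), t; split=> //.
  transitivity (m%:Z ^+ 2 * (x ^+ 2 + y ^+ 2 + 3 * z ^+ 2)); first by ring.
  by rewrite E NE PoszM -mulnn PoszM; ring.
have [s3|s3] := boolP (3%N \in s); last exact: rational_rep_coprime3.
rewrite (big_rem 3%N) //=.
have us' := rem_uniq 3%N us.
have ps' : all prime (rem 3%N s) by apply/allP => x /mem_rem; apply/allP.
have s3' : 3%N \notin rem 3%N s by rewrite mem_rem_uniq // !inE eqxx.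
apply: rational_rep_triple => //.
have c3 := coprime_prod_primes (isT : prime 3) ps' s3'.
have : ((\prod_(p <- rem 3%N s) p) %% 3 <> 2)%N.
  by move=> h; apply: Nex; rewrite NE (big_rem 3%N) //=; apply: excluded_mul_sqr.
rewrite prime_coprime // /dvdn in c3.
have := ltn_pmod (\prod_(p <- rem 3%N s) p) (isT : 0 < 3)%N.
by move: c3; move: (_ %% _)%N => [|[|[|]]].
Qed.

(** At half-integers x^2 + y^2 + 3z^2 takes the value 5/4, too large for the descent. Here y^2 +
    3z^2, the norm of Z[sqrt -3], is replaced by the norm of the larger ring of Eisenstein
    integers. *)
Definition gform (x y z : int) := x ^+ 2 + (y ^+ 2 + y * z + z ^+ 2).

Lemma centered_quotient (A t : int) : 0 < t -> exists x, - t <= A - 2 * t * x <= t.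
Proof.
move=> t0; have t2 : 2 * t != 0 by rewrite mulf_neq0 // gt_eqF.
exists ((A + t) %/ (2 * t))%Z.
have := divz_eq (A + t) (2 * t); have := modz_ge0 (A + t) t2.
have t2' : 0 < 2 * t by rewrite mulr_gt0.
have := ltz_pmod (A + t) t2'.
set r := (_ %% _)%Z; set q := (_ %/ _)%Z; rewrite [q * _]mulrC.
by move: (2 * t * q) => w; lia.
Qed.

Lemma sqr_le_sqr (u t : int) : - t <= u <= t -> u ^+ 2 <= t ^+ 2.
Proof.
move=> /andP[h1 h2]; have a1 : 0 <= t - u by lia.
have a2 : 0 <= t + u by lia.
by have := mulr_ge0 a1 a2; rewrite -subr_sqr subr_ge0.
Qed.

Lemma gform_squares (x y z : int) :
  4 * gform x y z = 4 * x ^+ 2 + (2 * y + z) ^+ 2 + 3 * z ^+ 2.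
Proof. by rewrite /gform; ring. Qed.

Lemma gform_ge0 (x y z : int) : 0 <= gform x y z.
Proof.
have := gform_squares x y z; move: (gform x y z) => g.
have := sqr_ge0 x; have := sqr_ge0 (2 * y + z); have := sqr_ge0 z; lra.
Qed.

Lemma gform_eq0 (x y z : int) : gform x y z = 0 -> [/\ x = 0, y = 0 & z = 0].
Proof.
have := gform_squares x y z => + E; rewrite E.
have := sqr_ge0 x; have := sqr_ge0 (2 * y + z); have := sqr_ge0 z => h1 h2 h3 h.
have /eqP : x ^+ 2 = 0 by lra.
have /eqP : z ^+ 2 = 0 by lra.
have /eqP : (2 * y + z) ^+ 2 = 0 by lra.
by rewrite !sqrf_eq0 => /eqP e1 /eqP e2 /eqP e3; split=> //; lia.
Qed.

(* Davenport-Cassels descent: every rational point is at [gform]-distance at most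
   [11/16 < 1] from an integral point, so the second intersection of the line joining
   them with the quadric [gform = N] has a smaller denominator. *)
Lemma gform_integral (N X Y Z t : int) : t != 0 -> gform X Y Z = N * t ^+ 2 ->
  exists x y z, gform x y z = N.
Proof.
wlog t0 : t / 0 < t.
  move=> H tn E; have [t0|t0] : 0 < t \/ 0 < - t by move: tn; clear; lia.
    exact: (H t).
  by apply: (H (- t)) => //; rewrite ?oppr_eq0 ?sqrrN.
move=> _; have [n nt] : exists n : nat, t = n%:Z by exists `|t|%N; lia.
elim/ltn_ind: n X Y Z t t0 nt => n IH X Y Z t t0 nt E.
have [x /sqr_le_sqr hx] := centered_quotient (2 * X) t0.
have [z /sqr_le_sqr hz] := centered_quotient (2 * Z) t0.
(* y is rounded after z, because completing the square in [gform] involves y + z/2. *)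
have [y /sqr_le_sqr hy] := centered_quotient (2 * Y + (Z - t * z)) t0.
pose dd := gform (X - t * x) (Y - t * y) (Z - t * z).
have dlt : dd < t ^+ 2.
  have t2 : 0 < t ^+ 2 by rewrite exprn_gt0.
  have d16 : 16 * dd = 4 * (2 * X - 2 * t * x) ^+ 2
    + 4 * (2 * Y + (Z - t * z) - 2 * t * y) ^+ 2 + 3 * (2 * Z - 2 * t * z) ^+ 2.
    by rewrite /dd /gform; ring.
  move: hx hy hz t2 d16.
  move: (_ ^+ 2) (_ ^+ 2) (_ ^+ 2) (t ^+ 2) dd => u1 u2 u3 u4 u5; lra.
have dge : 0 <= dd by apply: gform_ge0.
have [d0|d0] : dd = 0 \/ 0 < dd by move: dge; clear; lia.
  have [hX hY hZ] := gform_eq0 d0; exists x, y, z.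
  have t2 : t ^+ 2 != 0 by rewrite expf_neq0 // gt_eqF.
  apply: (mulIf t2); rewrite -E.
  have -> : X = t * x by apply/eqP; rewrite -subr_eq0 hX.
  have -> : Y = t * y by apply/eqP; rewrite -subr_eq0 hY.
  have -> : Z = t * z by apply/eqP; rewrite -subr_eq0 hZ.
  by rewrite /gform; ring.
(* P is the polar form of [gform] at (X, Y, Z) and (x, y, z); it gives the second intersection,
   whose denominator t' satisfies t t' = dd. *)
pose P := 2 * X * x + 2 * Y * y + Y * z + Z * y + 2 * Z * z.
pose a := gform x y z - N; pose b := 2 * N * t - P.
pose t' := a * t + b.
have tt' : t * t' = dd.
  have : gform X Y Z - N * t ^+ 2 = 0 by rewrite E subrr.
  rewrite /t' /a /b /dd /P /gform => h.
  by apply/eqP; rewrite -subr_eq0 -[X in _ == X]oppr0 -h; apply/eqP; ring.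
have t'0 : 0 < t' by rewrite -(pmulr_rgt0 _ t0) tt'.
have t't : t' < t by rewrite -(ltr_pM2l t0) tt' -expr2.
have [n' n't] : exists n' : nat, t' = n'%:Z.
  by exists `|t'|%N; move: t'0; clear; lia.
apply: (IH n' _ (a * X + b * x) (a * Y + b * y) (a * Z + b * z) t') => //.
  by move: t't; rewrite nt n't ltz_nat.
transitivity (a ^+ 2 * gform X Y Z + a * b * P + b ^+ 2 * gform x y z).
  by rewrite /gform /P; ring.
by rewrite E /t' /a /b; ring.
Qed.

Lemma gform_rep N : (0 < N)%N -> ~ excluded N -> exists x y z, gform x y z = N%:Z.
Proof.
move=> N0 Nex; have [x [y [z [t [t0 E]]]]] := rational_rep N0 Nex.
apply: (@gform_integral _ x (y - z) (2 * z) t) => //.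
by rewrite -E /gform; ring.
Qed.

(** * Parity: an odd third coordinate *)

Lemma even_or_odd (x : int) : exists k, x = 2 * k \/ x = 2 * k + 1.
Proof. by exists (x %/ 2)%Z; lia. Qed.

(* [4 (a^2 + 3 c^2) = (a + 3 c)^2 + 3 (a - c)^2]. *)
Lemma odd_coordinate (N a b c : int) : N = a ^+ 2 + b ^+ 2 + 3 * c ^+ 2 ->
  (exists k, a - c = 2 * k + 1) ->
  exists x y k, 4 * N = x ^+ 2 + y ^+ 2 + 3 * (2 * k + 1) ^+ 2.
Proof.
move=> -> [k ac]; exists (a + 3 * c), (2 * b), k; rewrite -ac; ring.
Qed.

Lemma four_rep N : (0 < N)%N -> ~ excluded N ->
  exists x y k : int, 4 * N%:Z = x ^+ 2 + y ^+ 2 + 3 * (2 * k + 1) ^+ 2.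
Proof.
elim/ltn_ind: N => N IH N0 Nex.
have [x [y [z E]]] := gform_rep N0 Nex.
have [z' [zE|zE]] := even_or_odd z; last first.
  by exists (2 * x), (2 * y + z), z'; rewrite -E -zE /gform; ring.
have [y' [yE|yE]] := even_or_odd y; last first.
  by exists (2 * x), (2 * z + y), y'; rewrite -E -yE /gform; ring.
pose b := 2 * y' + z'.
have {}E : N%:Z = x ^+ 2 + b ^+ 2 + 3 * z' ^+ 2 by rewrite -E zE yE /gform /b; ring.
have [x' [xE|xE]] := even_or_odd x; have [w [wE|wE]] := even_or_odd z'.
(* All of x, b, z' are even, so N = 4M, and the induction hypothesis already represents N = 4M with
   an odd third coordinate. Modulo 4 one of p, q is even, so [odd_coordinate] passes from N to
   4N. *)
- have NE : N%:Z = 4 * (x' ^+ 2 + (y' + w) ^+ 2 + 3 * w ^+ 2).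
    by rewrite E /b xE wE; ring.
  have [M ME] : exists M, N = (4 * M)%N.
    by exists (N %/ 4)%N; move: NE; move: (_ + _ + _) => v; clear; lia.
  have [|||p [q [k kE]]] := IH M.
  + by rewrite ME in N0 *; lia.
  + by rewrite ME in N0; lia.
  (* 4(3m + 2) = 3(4m + 2) + 2. *)
  + case=> j [m mE]; apply: Nex; exists j, (4 * m + 2)%N.
    by rewrite ME mE; ring.
  have {}kE : N%:Z = p ^+ 2 + q ^+ 2 + 3 * (2 * k + 1) ^+ 2 by rewrite -kE ME PoszM.
  have [p' [pE|pE]] := even_or_odd p.
    by apply: odd_coordinate kE _; exists (p' - k - 1); rewrite pE; ring.
  have [q' [qE|qE]] := even_or_odd q.
    rewrite [p ^+ 2 + _]addrC in kE.
    by apply: odd_coordinate kE _; exists (q' - k - 1); rewrite qE; ring.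
  exfalso; move: kE; rewrite ME PoszM pE qE.
  have -> : (2 * p' + 1) ^+ 2 + (2 * q' + 1) ^+ 2 + 3 * (2 * k + 1) ^+ 2 =
    4 * (p' ^+ 2 + p' + q' ^+ 2 + q' + 3 * k ^+ 2 + 3 * k + 1) + 1 by ring.
  move: (p' ^+ 2 + _ + _ + _ + _ + _ + 1) (M%:Z) => u v; clear; lia.
- by apply: odd_coordinate E _; exists (x' - w - 1); rewrite xE wE; ring.
- by apply: odd_coordinate E _; exists (x' - w); rewrite xE wE; ring.
(* Both b and z' are odd, so 4 divides b - z' or b + z'. Multiplying b + z' sqrt(-3) by a suitable
   cube root of unity then makes the coefficient of sqrt(-3) even, while x is odd. *)
- have [v [bv|bv]] : exists v, b - z' = 4 * v \/ b + z' = 4 * v.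
    have [v vE] := even_or_odd y'.
    exists (if y' == 2 * v then v else v + w + 1); rewrite /b wE.
    by move: vE; clear; case: eqP; lia.
  + have E' : N%:Z = x ^+ 2 + (2 * v + 2 * z') ^+ 2 + 3 * (2 * v) ^+ 2.
      have -> : x ^+ 2 + (2 * v + 2 * z') ^+ 2 + 3 * (2 * v) ^+ 2 =
        x ^+ 2 + (z' + 4 * v) ^+ 2 + 3 * z' ^+ 2 by ring.
      by rewrite -bv E; congr (_ + _ + _); congr (_ ^+ _); ring.
    by apply: odd_coordinate E' _; exists (x' - v); rewrite xE; ring.
  + have E' : N%:Z = x ^+ 2 + (2 * v - 2 * z') ^+ 2 + 3 * (2 * v) ^+ 2.
      have -> : x ^+ 2 + (2 * v - 2 * z') ^+ 2 + 3 * (2 * v) ^+ 2 =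
        x ^+ 2 + (4 * v - z') ^+ 2 + 3 * z' ^+ 2 by ring.
      by rewrite -bv E; congr (_ + _ + _); congr (_ ^+ _); ring.
    by apply: odd_coordinate E' _; exists (x' - v); rewrite xE; ring.
Qed.

(** * The obstruction modulo 3 and the conclusion *)

Lemma sqr_mod3 (u : int) :
  (exists k, u = 3 * k) \/ (exists k, u ^+ 2 = 3 * k + 1).
Proof.
have [h|[h|h]] : (u %% 3 = 0 \/ (u %% 3 = 1 \/ u %% 3 = 2))%Z by lia.
- by left; exists (u %/ 3)%Z; lia.
- right; have [k ->] : exists k, u = 3 * k + 1 by exists (u %/ 3)%Z; lia.
  by exists (3 * k ^+ 2 + 2 * k); ring.
- right; have [k ->] : exists k, u = 3 * k + 2 by exists (u %/ 3)%Z; lia.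
  by exists (3 * k ^+ 2 + 4 * k + 1); ring.
Qed.

Lemma sum_sqr_mod3 (a b : int) : (3 %| a ^+ 2 + b ^+ 2)%Z ->
  exists a' b', a = 3 * a' /\ b = 3 * b'.
Proof.
have [[k kE]|[k kE]] := sqr_mod3 a; have [[l lE]|[l lE]] := sqr_mod3 b.
- by exists k, l.
- by rewrite lE kE exprMn; move: (k ^+ 2) => v; lia.
- by rewrite kE lE exprMn; move: (l ^+ 2) => v; lia.
- by rewrite kE lE; lia.
Qed.

(** As -1 is not a square modulo 3, 3 divides a and b. After division by 3, either j = 0 and c^2 = 2
    mod 3, which is impossible, or 3 divides c and j drops by one. *)
Lemma excluded_not_rep j (m : nat) (a b c : int) :
  a ^+ 2 + b ^+ 2 + 3 * c ^+ 2 <> 3 ^+ (2 * j + 1) * (3 * m%:Z + 2).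
Proof.
elim: j a b c => [|j IH] a b c E.
  have [|a' [b' [aE bE]]] := @sum_sqr_mod3 a b.
    apply/dvdzP; exists (3 * m%:Z + 2 - c ^+ 2); move: E; rewrite expr1; lra.
  have h : c ^+ 2 = 3 * (m%:Z - a' ^+ 2 - b' ^+ 2) + 2.
    by move: E; rewrite aE bE expr1 !exprMn; lra.
  have [[k kE]|[k kE]] := sqr_mod3 c; move: h; rewrite kE ?exprMn.
    by move: (k ^+ 2) (_ - _ - _) => u v; lia.
  by move: (_ - _ - _) => v; lia.
have e3 : 3 ^+ (2 * j.+1 + 1) = 9 * 3 ^+ (2 * j + 1) :> int.
  have -> : (2 * j.+1 + 1 = (2 * j + 1).+2)%N by lia.
  by rewrite !exprS mulrA.
rewrite e3 in E; move: (3 ^+ (2 * j + 1)) E IH {e3} => u E IH.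
have [|a' [b' [aE bE]]] := @sum_sqr_mod3 a b.
  apply/dvdzP; exists (3 * u * (3 * m%:Z + 2) - c ^+ 2).
  by rewrite (canRL (addrK _) E); ring.
have h : c ^+ 2 = 3 * (u * (3 * m%:Z + 2) - a' ^+ 2 - b' ^+ 2).
  by move: E; rewrite aE bE !exprMn; lra.
have [[k kE]|[k kE]] := sqr_mod3 c.
  apply: (IH a' b' k); move: h; rewrite kE exprMn; lra.
by move: h; rewrite kE; move: (_ - _ - _) => v; lia.
Qed.

Theorem theorem3p9 (n : int) (n_gt0 : 0 < n) :
  (exists x y z : int, triangular x + triangular y + 6 * triangular z = n) <->
  (forall r : nat, (0 < r)%N ->
     (n != 2 * 3 ^+ (2 * r - 1)%N - 1 %[mod 3 ^+ (2 * r)%N])%Z).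
Proof.
have tri (x : int) : 8 * triangular x + 1 = (2 * x - 1) ^+ 2.
  have [k xE] := even_or_odd x.
  have [h hE] : exists h, x * (x - 1) = h * 2.
    by case: xE => ->; [exists (k * (2 * k - 1)) | exists ((2 * k + 1) * k)]; ring.
  by rewrite /triangular hE mulzK //; rewrite expr2; lra.
have [N NE] : exists N : nat, n + 1 = N%:Z by exists `|(n + 1)%R|%N; lia.
have N0 : (0 < N)%N by lia.
have exclE : excluded N <-> exists r, (0 < r)%N /\
    (n == 2 * 3 ^+ (2 * r - 1)%N - 1 %[mod 3 ^+ (2 * r)%N])%Z.
  split=> [[j [m mE]]|[r [r0]]].
    exists j.+1; split=> //; rewrite eqz_mod_dvd.
    have -> : (2 * j.+1 - 1 = 2 * j + 1)%N by lia.
    have -> : (2 * j.+1 = (2 * j + 1).+1)%N by lia.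
    have -> : n - (2 * 3 ^+ (2 * j + 1) - 1) = m%:Z * 3 ^+ (2 * j + 1).+1.
      have -> : n = N%:Z - 1 by rewrite -NE addrK.
      by rewrite mE excluded_form_int exprS; ring.
    by rewrite dvdz_mull.
  rewrite eqz_mod_dvd => /dvdzP[q].
  have -> : (2 * r = (2 * r - 1).+1)%N by lia.
  rewrite subSS subn0 => qE; set e := (2 * r - 1)%N in qE.
  have {qE} qE : N%:Z = 3 ^+ e * (3 * q + 2).
    by rewrite -NE (canRL (subrK _) qE) exprS; ring.
  have q0 : 0 <= q.
    have : 0 < 3 ^+ e * (3 * q + 2) by rewrite -qE.
    by rewrite pmulr_rgt0 ?exprn_gt0 //; clear; lia.
  exists r.-1, `|q|%N.
  have -> : (2 * r.-1 + 1 = e)%N by rewrite /e; lia.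
  by apply/eqP; rewrite -eqz_nat qE excluded_form_int gez0_abs.
split.
- case=> x [y [z E]] r r0; apply/negP => h.
  have [j [m mE]] : excluded N by apply/exclE; exists r.
  (* (2x - 1)^2 + (2y - 1)^2 = 2((x + y - 1)^2 + (x - y)^2), so 8N halves to a representation of 4N,
     and 4N is again of the excluded form. *)
  apply: (@excluded_not_rep j (4 * m + 2)%N (x + y - 1) (x - y) (2 * z - 1)).
  have -> : 3 ^+ (2 * j + 1) * (3 * (4 * m + 2)%N%:Z + 2) = 4 * N%:Z.
    by rewrite mE excluded_form_int PoszD PoszM; ring.
  rewrite -NE -E; have := tri x; have := tri y; have := tri z.
  by rewrite !expr2; lra.
- move=> H; have Nex : ~ excluded N.
    by move=> /exclE[r [r0 h]]; move: (H r r0); rewrite h.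
  have [a [b [k E]]] := four_rep N0 Nex.
  (* Since 2k + 1 is odd, a^2 + b^2 is 1 modulo 4, so a and b have opposite parity and a + b, a - b
     are odd. *)
  have [X [Y [XE YE]]] : exists X Y, a + b = 2 * X - 1 /\ a - b = 2 * Y - 1.
    have [p [pE|pE]] := even_or_odd a; have [q [qE|qE]] := even_or_odd b.
    - exfalso; move: E; rewrite pE qE !exprMn !expr2; clear; nia.
    - by exists (p + q + 1), (p - q); rewrite pE qE; split; ring.
    - by exists (p + q + 1), (p - q + 1); rewrite pE qE; split; ring.
    - exfalso; move: E; rewrite pE qE !expr2; clear; nia.
  exists X, Y, (k + 1).
  have := tri X; have := tri Y; have := tri (k + 1); rewrite -XE -YE.
  move: E; rewrite -NE !expr2; lra.
Qed.
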